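(* Let $M$ be a continuous local martingale vanishing at $0$, with quadratic variation $\langle M,M\rangle$, and let $N_m$ ($m\ge 0$) be its discrete quadratic variation processes. (i) For every fixed $K>0$ and every sequence $(c_m)$ increasing to $\infty$ (arbitrarily slowly), \[ \sup_{0\le t\le K}\left|\langle M,M\rangle_t-N_m(t)\right|<c_m\,m^{1/2}\,2^{-m}\qquad\text{a.s.}\quad(m\to\infty). \] (ii) There is a positive integer $m_4$ (an absolute constant) such that the following holds. Suppose that there is a finite valued function $g$ with $g(t)\ge\max\{t,e\}$ such that for each $t>0$ the quadratic variation satisfies $\langle M,M\rangle_t\le g(t)$ almost surely. Then for any $m\ge m_4$, \[ \sup_{0\le t\le K}\left|\langle M,M\rangle_t-N_m(t)\right|<g(K)^{1/2}(\log g(K))^{1/2}\qquad\text{a.s.}\quad(K\to\infty). \]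
   Context: $M=(M(t),t\ge0)$ is adapted to a filtration $(\mathcal F_t)_{t\ge0}$ on a probability space $(\Omega,\mathcal F,\mathbf P)$. Its quadratic variation $\langle M,M\rangle_t$ has a.s. continuous non-decreasing paths vanishing at $0$. Stopping times: $\tau_m(0)=0$ and $\tau_m(k+1)=\inf\{t:t>\tau_m(k),\ |M(t)-M(\tau_m(k))|=2^{-m}\}$ for $k\ge0$, with $\inf\emptyset=\infty$. Discrete quadratic variation process: $N_m(t)=2^{-2m}\,\#\{r:\ r>0,\ \tau_m(r)\le t\}$, $t\ge0$ ($r$ integer). An inequality followed by ''a.s. $(m\to\infty)$'' (resp. ''a.s. $(K\to\infty)$'') means that, almost surely, it holds for all sufficiently large $m$ (resp. all sufficiently large $K$), where the threshold may depend on $\omega$. *)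

(* Defs.v *)
From HB Require Import structures.
From mathcomp Require Import all_boot all_order all_algebra.
From mathcomp Require Import all_classical all_reals all_analysis.

Set Implicit Arguments.
Unset Strict Implicit.
Unset Printing Implicit Defensive.

Import Order.TTheory GRing.Theory Num.Theory.
Import numFieldNormedType.Exports.

Local Open Scope classical_set_scope.
Local Open Scope ring_scope.

(* A process is a function [X : R -> T -> R] of time and outcome.  Time is the
   half-line [0, +oo[: values at negative times are junk and never used.
   Filtrations are arbitrary (neither complete nor right-continuous), and path
   properties are only required almost surely. *)

Section Processes.
Context {R : realType} {d : measure_display} {T : measurableType d}.
Implicit Types (P : probability T R) (F : R -> set (set T)) (X Q : R -> T -> R).

Definition filtration F : Prop :=
  [/\ forall t, 0 <= t -> sigma_algebra [set: T] (F t),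
      forall t, 0 <= t -> F t `<=` measurable
    & forall s t, 0 <= s -> s <= t -> F s `<=` F t].

Definition adapted F X : Prop :=
  forall t, 0 <= t -> forall B : set R, measurable B -> F t (X t @^-1` B).

Definition stopping_time F (S : T -> \bar R) : Prop :=
  (forall w, 0%E <= S w)%E /\
  (forall t, 0 <= t -> F t [set w | (S w <= t%:E)%E]).

(* [fine] is harmless: the minimum of a real number and of an element of
   [0, +oo] is finite. *)
Definition stopped X (S : T -> \bar R) : R -> T -> R :=
  fun t w => X (fine (Order.min t%:E (S w))) w.

(* E[X t | F s] = X s, written as the defining property of the conditional
   expectation. *)
Definition martingale P F X : Prop :=
  [/\ adapted F X,
      forall t, 0 <= t -> P.-integrable setT (EFin \o X t)
    & forall s t, 0 <= s -> s <= t -> forall A, F s A ->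
        (\int[P]_(w in A) (X t w)%:E = \int[P]_(w in A) (X s w)%:E)%E].

Definition local_martingale P F X : Prop :=
  adapted F X /\
  exists S : nat -> T -> \bar R,
    [/\ forall n, stopping_time F (S n),
        {ae P, forall w, nondecreasing_seq (S ^~ w) /\
                         S ^~ w @ \oo --> +oo%E}
      & forall n, martingale P F (stopped X (S n))].

Definition continuous_paths P X : Prop :=
  {ae P, forall w, {within `[0, +oo[, continuous (X ^~ w)}}.

Definition nondecreasing_paths P X : Prop :=
  {ae P, forall w, forall s t, 0 <= s -> s <= t -> X s w <= X t w}.

Definition vanishing_at_0 P X : Prop := {ae P, forall w, X 0 w = 0}.

Definition continuous_local_martingale P F X : Prop :=
  local_martingale P F X /\ continuous_paths P X.

(* Q is (a version of) <X, X>, for X a continuous local martingale vanishing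
   at 0: these properties determine Q up to indistinguishability. *)
Definition quadratic_variation P F X Q : Prop :=
  [/\ adapted F Q, continuous_paths P Q, nondecreasing_paths P Q,
      vanishing_at_0 P Q
    & local_martingale P F (fun t w => X t w ^+ 2 - Q t w)].

End Processes.

Section DiscreteQuadraticVariation.
Context {R : realType}.
Implicit Types (x : R -> R) (m k : nat).

(* The sequence tau_m along one path x.  When tau_m(k) = +oo the set below is
   empty, so that tau_m(k+1) = +oo whatever the value of [fine +oo]. *)
Fixpoint tau x m k : \bar R :=
  if k is k'.+1 then
    ereal_inf [set t%:E | t in
      [set t : R | (tau x m k' < t%:E)%E /\
                   `|x t - x (fine (tau x m k'))| = 2 ^- m]]
  else 0%E.

(* N_m(t) along one path x; the cardinal is finite if x is continuous, and is
   +oo if there are infinitely many such r. *)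
Definition discrete_qv x m (t : R) : \bar R :=
  ((2 ^- (2 * m))%:E *
   counting [set r : nat | (0 < r)%N /\ (tau x m r <= t%:E)%E])%E.

(* The supremum over [0, K] of |q(t) - N_m(t)|, in the extended reals. *)
Definition qv_error x (q : R -> R) m (K : R) : \bar R :=
  ereal_sup [set `|(q t)%:E - discrete_qv x m t|%E | t in `[0, K]].

End DiscreteQuadraticVariation.

(* Main.v *)
Require Import Defs.
From HB Require Import structures.
From mathcomp Require Import all_boot all_order all_algebra.
From mathcomp Require Import all_classical all_reals all_analysis.
From mathcomp Require Import measurable_realfun.
From mathcomp Require Import ring lra.
Import Order.TTheory GRing.Theory Num.Theory.
Import numFieldNormedType.Exports.
Local Open Scope classical_set_scope.
Local Open Scope ring_scope.

(** Fix the lattice step delta = 2^-m.  Let j_t be the last lattice point visited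
by M up to time t and k_t the number of steps made, so that N_m(t) is
delta^2 k_t.  Everything rests on the process
  V_t = (M_t - j_t)^2 + delta^2 k_t - Q_t,
which differs from N_m - Q by at most delta^2.  When M completes a lattice
step the square drops from delta^2 to 0 while delta^2 k_t grows by delta^2, so
V is continuous; it is in fact the local martingale 2 int (M - j) dM, and
since |M - j| <= delta its bracket is at most 4 delta^2 Q.  Hence
exp (lambda V - mu Q) is a supermartingale as soon as mu is a large enough
multiple of lambda^2 delta^2, and lambda V reaches the level y before Q
exceeds L with probability at most of order exp (- y + mu L) ([qv_tail]).
For a fixed horizon K, take lambda = sqrt m / delta and L an integer above Q_K;
for a fixed m and K -> +oo, take lambda = sqrt (j / e^j) and L = e^(j+1) when
e^j <= g(K) < e^(j+1).  In both cases the bound decays geometrically and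
Borel-Cantelli concludes.  In the second case the exceptional set must be the
same for all K although g is arbitrary: the bounds at countably many times
suffice because Q is monotone and continuous ([qv_le_envelope]).

The supermartingale inequality is obtained without stochastic integration, on
the time grid i * eta.  The localizing sequences provide two martingales, X
(the stopped M) and Y (the stopped M^2 - Q), and Q is read off as X^2 - Y.  On
the grid, the increment of exp (lambda V - mu Q) is at most
a dX + b dY + O(eps) dk with a and b known at the beginning of the step,
provided the step is small ([exp_step], [expo_step]).  The process is frozen
just before the first step that is not small.  This is not a stopping time,
as it looks one step ahead, so the martingale terms do not vanish; but they
are controlled by the last step alone ([transform_bound]), which is small by
uniform continuity of the paths, up to an error that vanishes as eta -> 0 by
dominated convergence ([jump_vanish]).

As the filtration may be incomplete and the paths are continuous only almost
surely, the crossing times need not be stopping times; moreover a grid may miss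
a crossing.  The grid
computation therefore uses a surrogate for (j, k) which is a function of the
grid values only: a step is recorded as soon as the distance to j is at least
delta - eps.  For a fixed continuous path the surrogate passes through the true
state of the path near any given time, once eps and then eta are small
([stage_reached]).  The limits in the horizon, in the localizing index, in
eps and in eta are taken pathwise, one after the other, through
[outer_le_liminf]. *)

Set Implicit Arguments.
Unset Strict Implicit.
Unset Printing Implicit Defensive.

(** * Continuous paths and their crossing times *)

Section Paths.
Context {R : realType}.
Implicit Types (x : R -> R) (s t u e : R).

Lemma path_continuous_at x t e : {within `[0, +oo[, continuous x} ->
  0 <= t -> 0 < e ->
  exists2 d, 0 < d & forall s, 0 <= s -> `|s - t| < d -> `|x s - x t| < e.
Proof.
move=> /subspace_continuousP cx t0 e0.
have /cvgrPdist_lt/(_ _ e0) : x @ within `[0, +oo[ (nbhs t) --> x t.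
  by apply: cx; rewrite /= in_itv/= andbT.
rewrite near_withinE => /nbhs_ballP[d /= d0 Hd]; exists d => // s s0 st.
rewrite distrC; apply: Hd => /=; last by rewrite in_itv/= andbT.
by rewrite /ball/= distrC.
Qed.

Lemma path_continuous_segment x s t : {within `[0, +oo[, continuous x} ->
  0 <= s -> {within `[s, t], continuous x}.
Proof.
move=> cx s0; apply: continuous_subspaceW cx => u /=.
by rewrite !in_itv/= andbT => /andP[su _]; exact: le_trans su.
Qed.

Definition unif_path x := forall t e, 0 < e ->
  exists2 d : R, 0 < d & forall s u,
    0 <= s <= t -> 0 <= u -> `|u - s| < d -> `|x u - x s| < e.

(** Heine's theorem, in the form of a near-covering argument on a segment. *)
Lemma path_unif_continuous x : {within `[0, +oo[, continuous x} -> unif_path x.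
Proof.
move=> cx t e e0.
pose P (d s : R) := 0 <= s -> forall u, 0 <= u -> `|u - s| < d ->
  `|x u - x s| < e.
have covP s : s \in `[0, t] ->
    \forall s' \near s & d \near 0^'+, P d s'.
  rewrite in_itv/= => /andP[s0 _].
  have [r r0 Hr] := path_continuous_at cx s0 (divr_gt0 e0 (ltr0n R 2)).
  have r20 : 0 < r / 2 by lra.
  exists (ball s (r / 2), [set d : R | d < r / 2]).
    by split => /=; [exact: nbhsx_ballx|exact: nbhs_right_lt].
  case=> s' d /= [bs' dr] s'0 u u0 us'; rewrite /ball/= in bs'.
  have h1 : `|x u - x s| < e / 2.
    by apply: Hr => //; rewrite ltr_norml; move: bs' us';
      rewrite !ltr_norml; lra.
  have h2 : `|x s' - x s| < e / 2.
    by apply: Hr => //; rewrite ltr_norml; move: bs'; rewrite !ltr_norml; lra.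
  by move: h1 h2; rewrite !ltr_norml; lra.
have /compact_near_coveringP/(_ _ _ P _ covP) := @segment_compact R 0 t.
move=> near0.
have [d [d0 Hd]] : exists d, 0 < d /\ `[0, t] `<=` P d.
  near (0 : R)^'+ => d; exists d; split; first by near: d; exact: nbhs_right_gt.
  by near: d; exact: near0.
exists d => // s u st; apply: Hd; first by rewrite /= in_itv.
by case/andP: st.
Unshelve. all: by end_near. Qed.

Lemma path_bounded x t : {within `[0, +oo[, continuous x} -> 0 <= t ->
  exists B, forall s, 0 <= s <= t -> `|x s| <= B.
Proof.
move=> cx t0.
have cax : {within `[0, t], continuous (fun s => `|x s|)}.
  have := @path_continuous_segment x 0 t cx (lexx 0).
  move=> c u; apply: continuous_comp; [exact: c|exact: norm_continuous].
have [c _ Hc] := EVT_max t0 cax.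
by exists `|x c| => s st; apply: Hc; rewrite in_itv.
Qed.

Lemma path_hit x s t b : {within `[0, +oo[, continuous x} -> 0 <= s -> s <= t ->
  0 <= b <= `|x t - x s| -> exists2 u, s <= u <= t & `|x u - x s| = b.
Proof.
move=> cx s0 st bx.
have cax : {within `[s, t], continuous (fun u => `|x u - x s|)}.
  have := @path_continuous_segment x s t cx s0.
  by move=> c u; apply: cvg_norm; apply: cvgB; [exact: c|exact: cvg_cst].
have [|u us ub] := IVT (v := b) st cax.
  rewrite subrr normr0; move/andP: bx => [b0 bx].
  by rewrite ge_min le_max b0 bx orbT.
by exists u => //; rewrite in_itv in us.
Qed.

End Paths.

Section CrossingTimes.
Context {R : realType} (x : R -> R) (m : nat).
Hypothesis cx : {within `[0, +oo[, continuous x}.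
Let delta : R := 2 ^- m.

Lemma delta_gt0 : 0 < delta. Proof. by rewrite invr_gt0 exprn_gt0. Qed.

Lemma tau_le k : (tau x m k <= tau x m k.+1)%E.
Proof.
by apply: le_ereal_inf_tmp => _ [t [+ _] <-]; exact: ltW.
Qed.

Lemma tau_homo k l : (k <= l)%N -> (tau x m k <= tau x m l)%E.
Proof.
by move/subnKC <-; elim: (l - k)%N => [|n IHn]; rewrite ?addn0// addnS
  (le_trans IHn)// tau_le.
Qed.

(** The infimum defining the next crossing time is attained because the
distance is continuous, and by the intermediate value theorem the distance is
below the lattice step before that time. *)
Lemma tau_succ k s : 0 <= s -> tau x m k = s%:E ->
  (tau x m k.+1 = +oo%E /\ forall t, s <= t -> `|x t - x s| < delta) \/
  exists s', [/\ tau x m k.+1 = s'%:E, s < s', `|x s' - x s| = delta &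
    forall t, s <= t < s' -> `|x t - x s| < delta].
Proof.
move=> s0 ks; have d0 := delta_gt0.
pose A := [set t : R | s < t /\ `|x t - x s| = delta].
have tauE : tau x m k.+1 = ereal_inf [set t%:E | t in A].
  by rewrite /= ks.
have lbA : lbound A s by move=> t [/ltW].
have hit t : s <= t -> delta <= `|x t - x s| -> exists2 a, A a & a <= t.
  move=> st dx; have [|u /andP[su ut] ud] := path_hit (b := delta) cx s0 st.
    by rewrite (ltW d0).
  exists u => //; split=> //; rewrite lt_neqAle su andbT; apply/eqP => usE.
  by move: ud; rewrite -usE subrr normr0 => dE; rewrite dE ltxx in d0.
have [A0|/set0P A0] := eqVneq A set0.
  left; split; first by rewrite tauE A0 image_set0 ereal_inf0.
  move=> t st; rewrite ltNge; apply/negP => /(hit _ st)[a].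
  by rewrite A0.
right; exists (inf A).
have hlA : has_lbound A by exists s.
have hiA : has_inf A by [].
have sA : s <= inf A by exact: lb_le_inf.
have xA : `|x (inf A) - x s| = delta.
  have i0 : 0 <= inf A by exact: le_trans sA.
  apply/eqP; rewrite -subr_eq0 -normr_eq0 eq_le normr_ge0 andbT.
  apply/ler_addgt0Pr => e e0; rewrite add0r.
  have [r r0 Hr] := path_continuous_at cx i0 e0.
  have [a [sa xa] ai] := inf_adherent r0 hiA.
  have a0 : 0 <= a by exact: le_trans (ltW sa).
  have ia : inf A <= a by exact: ge_inf.
  have := Hr a a0; rewrite ger0_norm ?subr_ge0// ltrBlDl => /(_ ai) xai.
  rewrite -xa (le_trans (ler_dist_dist _ _))// opprB addrA subrK distrC ltW//.
split => //.
- by rewrite tauE ereal_inf_EFin.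
- rewrite lt_neqAle sA andbT; apply/eqP => sE.
  by move: xA; rewrite -sE subrr normr0 => dE; rewrite dE ltxx in d0.
- move=> t /andP[st ti]; rewrite ltNge; apply/negP => /(hit _ st)[a Aa at_].
  have : inf A <= a by exact: ge_inf.
  by move=> /le_trans/(_ at_); rewrite leNgt ti.
Qed.

Definition stage t k s :=
  [/\ tau x m k = s%:E, 0 <= s <= t & (t%:E < tau x m k.+1)%E].

(** By uniform continuity consecutive crossing times before t are at least some
fixed d > 0 apart, so only finitely many of them precede t. *)
Lemma stage_exists t : 0 <= t -> exists k s, stage t k s.
Proof.
move=> t0; have d0 := delta_gt0.
have [d dgt0 Hd] := path_unif_continuous cx t d0.
have main k : (exists k s, stage t k s) \/
    exists2 s, tau x m k = s%:E & k%:R * d <= s <= t.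
  elim: k => [|k [IHk|[s ks /andP[kds st]]]]; first 2 last.
  - have s0 : 0 <= s by apply: le_trans kds; rewrite mulr_ge0// ltW.
    have [[koo _]|[s' [ks' ss' xs' _]]] := tau_succ s0 ks.
      left; exists k, s; split=> //; first by rewrite s0.
      by rewrite koo ltry.
    have [ts'|s't] := ltP t s'.
      left; exists k, s; split=> //; first by rewrite s0.
      by rewrite ks' lte_fin.
    right; exists s' => //; rewrite s't andbT.
    have : d <= s' - s.
      rewrite leNgt; apply/negP => s'sd.
      have := Hd s s'; rewrite s0 st xs' ltxx => /(_ isT).
      rewrite (le_trans s0 (ltW ss')) gtr0_norm ?subr_gt0// => /(_ isT).
      by move=> /(_ s'sd).
    by rewrite -natr1 mulrDl mul1r; lra.
  - by right; exists 0; rewrite ?mul0r ?lexx.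
  - by left.
have [] // := main (Num.bound (t / d)) => -[s _ /andP[bs st]].
have : t / d < (Num.bound (t / d))%:R.
  by rewrite archi_boundP// divr_ge0// ltW.
by rewrite ltr_pdivrMr// => /lt_le_trans/(_ bs)/lt_le_trans/(_ st); rewrite ltxx.
Qed.

Lemma discrete_qv_stage t k s : stage t k s ->
  discrete_qv x m t = (delta ^+ 2 * k%:R)%:E.
Proof.
move=> [ks /andP[s0 st] tk].
have -> : delta ^+ 2 = 2 ^- (2 * m) by rewrite exprVn -exprM mulnC.
rewrite /discrete_qv EFinM; congr (_ * _)%E.
have -> : [set r | (0 < r)%N /\ (tau x m r <= t%:E)%E] = succn @` `I_k.
  apply/seteqP; split=> r /=.
    move=> [r0 rt]; exists r.-1; last by rewrite prednK.
    rewrite prednK//; rewrite leqNgt; apply/negP => /tau_homo kr.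
    by move: (lt_le_trans tk kr); rewrite ltNge rt.
  move=> [j jk <-]; split => //; apply: le_trans (tau_homo jk) _.
  by rewrite ks lee_fin.
rewrite /counting asboolT; last by apply: finite_image; exact: finite_II.
congr ((_%:R)%:E); apply: card_fset_set.
by apply: inj_card_eq => i j _ _; exact: succn_inj.
Qed.

Lemma stage_dist t k s : stage t k s -> `|x t - x s| < delta.
Proof.
move=> [ks /andP[s0 st] tk].
have [[_]|[s' [ks' ss' _]]] := tau_succ s0 ks; first exact.
by apply; rewrite st -lte_fin -ks'.
Qed.

End CrossingTimes.

(** * Tracking the crossings on a grid *)

Section Hysteresis.
Context {R : realType}.
Variables (delta eps : R) (u : nat -> R).

(** The last lattice point, as seen on the grid.  The threshold lies strictly
below the lattice step: with threshold delta, a crossing that happens strictly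
between two grid times could be missed for ever if the path turns back. *)
Fixpoint hlevel (i : nat) : R :=
  if i is i'.+1 then
    if delta - eps <= `|u i - hlevel i'| then
      if hlevel i' <= u i then hlevel i' + delta else hlevel i' - delta
    else hlevel i'
  else 0.

Fixpoint hcount (i : nat) : R :=
  if i is i'.+1 then
    hcount i' + (delta - eps <= `|u i - hlevel i'|)%R%:R
  else 0.

Lemma hyst_stay i0 i : (i0 <= i)%N ->
  (forall i', (i0 < i' <= i)%N -> `|u i' - hlevel i0| < delta - eps) ->
  hlevel i = hlevel i0 /\ hcount i = hcount i0.
Proof.
move/subnKC <-; elim: (i - i0)%N => [|n IHn]; first by rewrite addn0.
rewrite addnS => H; have [|l c] := IHn.
  by move=> i' /andP[ii' i'n]; apply: H; rewrite ii' leqW.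
have /= := H (i0 + n).+1; rewrite ltnS leq_addr leqnn => /(_ isT).
by rewrite ltNge => /negbTE /=; rewrite l c => ->; rewrite addr0.
Qed.

End Hysteresis.

Section Tracking.
Context {R : realType} (x : R -> R) (delta : R).
Hypothesis cx : {within `[0, +oo[, continuous x}.
Hypothesis d0 : 0 < delta.

Implicit Types s t v w r rho k : R.

Definition sampled (eta : R) (i : nat) : R := x (i%:R * eta).

(** The grid computation is in state (j, k) at some grid time close to t, for
eps small and then for a mesh eta small depending on eps. *)
Definition reached (t j k : R) := forall rho, 0 < rho ->
  exists2 e0 : R, 0 < e0 & forall eps : R, 0 < eps < e0 ->
  exists2 eta0 : R, 0 < eta0 & forall eta : R, 0 < eta < eta0 ->
  exists i, [/\ `|i%:R * eta - t| <= rho,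
    hlevel delta eps (sampled eta) i = j & hcount delta eps (sampled eta) i = k].

Lemma grid_floor (t eta : R) : 0 <= t -> 0 < eta ->
  exists i : nat, i%:R * eta <= t < i%:R * eta + eta.
Proof.
move=> t0 eta0; exists (Num.truncn (t / eta)).
have := truncn_itv (divr_ge0 t0 (ltW eta0)).
by rewrite ler_pdivlMr// ltr_pdivrMr// -natr1 mulrDl mul1r.
Qed.

Lemma reached0 : reached 0 0 0.
Proof.
move=> rho rho0; exists 1 => // eps _; exists 1 => // eta _.
by exists 0%N; rewrite mul0r subr0 normr0 ltW.
Qed.

(** On a compact interval where the distance to the current lattice point stays
below delta, it stays below delta - eps for eps small: nothing is recorded. *)
Lemma reached_stay s t k : 0 <= s -> s < t -> reached s (x s) k ->
  (forall v, s <= v <= t -> `|x v - x s| < delta) -> reached t (x s) k.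
Proof.
have dp := d0; move=> s0 st rs Hx rho rho0.
have [r r0 Hr] := path_continuous_at cx s0 (divr_gt0 d0 (ltr0n R 2)).
have cax : {within `[s, t], continuous (fun v => `|x v - x s|)}.
  have := @path_continuous_segment _ x s t cx s0.
  by move=> c v; apply: cvg_norm; apply: cvgB; [exact: c|exact: cvg_cst].
have [c' cd Hc] : exists2 c' : R, c' < delta &
    forall v, v \in `[s, t] -> `|x v - x s| <= c'.
  have [c cst Hc] := EVT_max (ltW st) cax.
  by exists `|x c - x s| => //; apply: Hx; rewrite in_itv in cst.
have rho10 : 0 < Num.min (r / 2) ((t - s) / 2) by rewrite lt_min; apply/andP; split; lra.
have [e1 e10 He1] := rs _ rho10.
exists (Num.min e1 (Num.min (delta - c') (delta / 2))).
  by rewrite !lt_min e10/= subr_gt0 cd/=; lra.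
move=> eps; rewrite !lt_min => /andP[eps0 /and3P[epse1 epsc epsd]].
have [|eta1 eta10 Heta1] := He1 eps; first by rewrite eps0.
exists (Num.min eta1 (Num.min rho ((t - s) / 2))).
  by rewrite !lt_min eta10 rho0/=; lra.
move=> eta; rewrite !lt_min => /andP[eta0 /and3P[etaeta1 etarho etast]].
have [|i0 [i0s lev0 cnt0]] := Heta1 eta; first by rewrite eta0.
move: i0s; rewrite le_min !ler_norml => /andP[/andP[i0s1 i0s2] /andP[i0s3 i0s4]].
have [i1 /andP[i1t ti1]] := grid_floor (le_trans s0 (ltW st)) eta0.
have i01 : (i0 <= i1)%N.
  by rewrite -(ler_nat R) -(ler_pM2r eta0); lra.
have [|l cn] := @hyst_stay R delta eps (sampled eta) i0 i1 i01.
  move=> i /andP[i0i ii1]; rewrite lev0 /sampled.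
  have h1 : i0%:R * eta <= i%:R * eta by rewrite ler_pM2r// ler_nat ltnW.
  have h2 : i%:R * eta <= i1%:R * eta by rewrite ler_pM2r// ler_nat.
  have [vs|sv] := ltP (i%:R * eta) s.
    apply: lt_le_trans (Hr _ _ _) _; last lra.
      by rewrite mulr_ge0// ltW.
    by rewrite ltr_norml; lra.
  apply: le_lt_trans (Hc _ _) _; last lra.
  by rewrite in_itv/= sv; lra.
exists i1; rewrite l cn; split => //.
by rewrite ler_norml; lra.
Qed.

(** The grid computation can record the step slightly before s', the distance
being then already delta - eps, and at the latest one grid step after s'.  Both
happen close to s', where the path is close to the new lattice point, so that
the step is recorded in the right direction. *)
Lemma reached_switch s s' k : 0 <= s -> s < s' -> reached s (x s) k ->
  `|x s' - x s| = delta ->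
  (forall v, s <= v < s' -> `|x v - x s| < delta) -> reached s' (x s') (k + 1).
Proof.
have dp := d0; move=> s0 ss' rs xs' Hx rho rho0.
have s'0 : 0 <= s' by exact: le_trans (ltW ss').
have [r r0 Hr] := path_continuous_at cx s'0 (divr_gt0 d0 (ltr0n R 2)).
pose rh := Num.min (Num.min (r / 4) (rho / 4)) ((s' - s) / 2).
have rh0 : 0 < rh by rewrite !lt_min; apply/andP; split; [apply/andP; split|]; lra.
have [rhr rhrho rhs] : [/\ rh <= r / 4, rh <= rho / 4 & rh <= (s' - s) / 2].
  by split; rewrite !ge_min ?lexx ?orbT.
have ru : reached (s' - rh) (x s) k.
  by apply: reached_stay => //; [lra | move=> v vs; apply: Hx; lra].
have [e1 e10 He1] := ru (rh / 2) ltac:(lra).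
exists (Num.min e1 (delta / 2)); first by rewrite !lt_min e10/=; lra.
move=> eps; rewrite !lt_min => /andP[eps0 /andP[epse1 epsd]].
have [|eta1 eta10 Heta1] := He1 eps; first by rewrite eps0.
have [r' r'0 Hr'] := path_continuous_at cx s'0 eps0.
exists (Num.min eta1 (Num.min r' rh)); first by rewrite lt_min eta10 lt_min r'0.
move=> eta; rewrite !lt_min => /andP[eta0 /and3P[etaeta1 etar' etarh]].
have [|i0 [+ lev0 cnt0]] := Heta1 eta; first by rewrite eta0.
rewrite ler_norml => /andP[i0s1 i0s2].
(* The grid time following s' has certainly recorded the step. *)
have [i1 /andP[i1t ti1]] := grid_floor s'0 eta0.
pose Q i := (i0 < i)%N && (delta - eps <= `|sampled eta i - x s|).
have i1E : i1.+1%:R * eta = i1%:R * eta + eta by rewrite -natr1 mulrDl mul1r.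
have Qi1 : Q i1.+1.
  apply/andP; split.
    by rewrite -(ltr_nat R) -(ltr_pM2r eta0) i1E; lra.
  have : `|sampled eta i1.+1 - x s'| < eps.
    by apply: Hr'; rewrite i1E ?ltr_norml; lra.
  rewrite -xs' lerBlDl => h.
  rewrite -[x s' - x s](subrK (sampled eta i1.+1 - x s)) (le_trans (ler_normD _ _))//.
  by rewrite lerD2r opprB addrA subrK distrC ltW.
have exQ : exists i, Q i by exists i1.+1.
case: (ex_minnP exQ) => i /andP[i0i Qi] imin.
have ii1 : (i <= i1.+1)%N by exact: imin.
case: i => [//|i] in i0i Qi imin ii1 *.
have h1 : i0%:R * eta < i.+1%:R * eta by rewrite ltr_pM2r// ltr_nat.
have h2 : i.+1%:R * eta <= i1.+1%:R * eta by rewrite ler_pM2r// ler_nat.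
have [|l cn] := @hyst_stay R delta eps (sampled eta) i0 i i0i.
  move=> i' /andP[i0i' i'i]; rewrite lev0 ltNge; apply/negP => qi'.
  by have := imin i'; rewrite /Q i0i' qi' leqNgt ltnS i'i => /(_ isT).
have : `|sampled eta i.+1 - x s'| < delta / 2.
  by apply: Hr; [rewrite mulr_ge0// ltW|rewrite ltr_norml; lra].
rewrite ltr_norml => /andP[xl xr].
exists i.+1; rewrite [hlevel _ _ _ _]/= [hcount _ _ _ _]/= l lev0 cn cnt0 Qi.
split => //; first by rewrite ler_norml; lra.
move: xs'; have [xx|xx] := leP (x s) (x s').
  rewrite ger0_norm ?subr_ge0// => xs'.
  by rewrite ifT; lra.
rewrite ltr0_norm ?subr_lt0// => xs'.
by rewrite ifF; [lra|apply/negbTE; rewrite -ltNge; lra].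
Qed.

End Tracking.

(** Follow the path from one crossing time to the next. *)
Lemma stage_reached (R : realType) (x : R -> R) (m : nat) (t s : R) (k : nat) :
  {within `[0, +oo[, continuous x} -> x 0 = 0 ->
  stage x m t k s -> reached x (2 ^- m) t (x s) k%:R.
Proof.
move=> cx x0 [ks /andP[s0 st] tk]; have d0 := @delta_gt0 R m.
have main l v : 0 <= v -> tau x m l = v%:E -> reached x (2 ^- m) v (x v) l%:R.
  elim: l v => [|l IHl] v v0.
    by move=> [<-]; rewrite x0; exact: reached0.
  move=> lv; have : (0 <= tau x m l <= v%:E)%E.
    by rewrite -lv tau_le// (le_trans _ (@tau_homo _ x m 0 l _)).
  case lw : (tau x m l) => [w| |]; rewrite ?leye_eq ?leeNy_eq ?andbF//.
  rewrite !lee_fin => /andP[w0 wv].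
  have [[]|[w' [+ ww' xw' Hw]]] := tau_succ cx w0 lw; rewrite lv// => -[vw'].
  by rewrite -[l.+1%:R]natr1; apply: (reached_switch cx d0 w0) => //; rewrite ?vw'//; exact: IHl.
move: st; rewrite le_eqVlt => /predU1P[<-|st]; first exact: main.
apply: reached_stay => //; first exact: main.
move=> v /andP[sv vt]; apply: (@stage_dist _ x m cx _ k); split => //.
  by rewrite s0.
by apply: le_lt_trans tk; rewrite lee_fin.
Qed.

(** * Expectations and sub-sigma-algebras *)

Notation gmeas G f :=
  (measurable_fun [set: g_sigma_algebraType G] (f : g_sigma_algebraType G -> _)).
Notation intR P f := (P.-integrable setT (EFin \o f)).

Section SubSigmaAlgebra.
Context {R : realType} {d : measure_display} {T : measurableType d}.
Implicit Types (G H : set (set T)).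

Lemma gmeas_sub d' (U : measurableType d') G H (f : T -> U) : G `<=` H ->
  gmeas G f -> gmeas H f.
Proof.
move=> GH mf _ B mB; apply: (sub_sigma_algebra2 GH).
exact: (mf measurableT B mB).
Qed.

Lemma gmeas_measurable d' (U : measurableType d') G (f : T -> U) :
  G `<=` @measurable d T -> gmeas G f -> measurable_fun setT f.
Proof.
move=> GH mf _ B mB; have := mf measurableT B mB.
apply: (@smallest_sub _ _ _ (@measurable d T)) => //.
exact: sigma_algebra_measurable.
Qed.

Lemma gmeas_set G (b : T -> bool) : sigma_algebra setT G ->
  gmeas G b -> G [set w | b w].
Proof.
move=> sG mb; have := mb measurableT [set true] I.
rewrite setTI [X in X -> _](_ : _ = <<s G >> (b @^-1` [set true]))//.
by rewrite (sigma_algebra_id sG).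
Qed.

Lemma adapted_gmeas (F : R -> set (set T)) (X : R -> T -> R) t :
  adapted F X -> 0 <= t -> gmeas (F t) (X t).
Proof.
move=> aX t0 _ B mB; rewrite setTI; apply: sub_sigma_algebra; exact: aX.
Qed.

Lemma gmeas_ind G (b : T -> bool) : gmeas G b -> gmeas G (fun w => (b w)%:R : R).
Proof.
move=> mb; rewrite (_ : (fun w => _) = (fun w => if b w then 1 else 0)).
  by apply: measurable_fun_ifT => //; exact: measurable_cst.
by apply/funext => w; case: (b w).
Qed.

End SubSigmaAlgebra.

Section Integrals.
Context {R : realType} {d : measure_display} {T : measurableType d}.
Variable P : probability T R.
Implicit Types (f g a X Y Z : T -> R) (C c e : R).

Lemma intR_mul a f C : measurable_fun setT a -> (forall w, `|a w| <= C) ->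
  intR P f -> intR P (fun w => a w * f w).
Proof.
move=> ma aC fi.
have -> : EFin \o (fun w => a w * f w) = ((EFin \o a) \* (EFin \o f))%E.
  by apply/funext => w /=; rewrite EFinM.
apply: integrableMr => //; exists C; split; first exact: num_real.
by move=> M CM w _; exact: le_trans (aC w) (ltW CM).
Qed.

Lemma intR_bounded a C : measurable_fun setT a -> (forall w, `|a w| <= C) ->
  intR P a.
Proof.
move=> ma aC; apply: measurable_bounded_integrable => //.
  exact: fin_num_fun_lty.
exists C; split; first exact: num_real.
by move=> M CM w _; exact: le_trans (aC w) (ltW CM).
Qed.

Lemma intR_cst c : intR P (fun=> c).
Proof. exact: (@intR_bounded (fun=> c) `|c|). Qed.

Lemma intRD f g : intR P f -> intR P g -> intR P (fun w => f w + g w).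
Proof.
move=> fi gi; rewrite (_ : EFin \o _ = ((EFin \o f) \+ (EFin \o g))%E)//.
exact: integrableD.
Qed.

Lemma intRZ c f : intR P f -> intR P (fun w => c * f w).
Proof.
move=> fi; apply: (@intR_mul (fun=> c) f `|c|) => //.
Qed.

Lemma intRB f g : intR P f -> intR P g -> intR P (fun w => f w - g w).
Proof.
move=> fi gi; rewrite (_ : EFin \o _ = ((EFin \o f) \- (EFin \o g))%E)//.
exact: integrableB.
Qed.

Lemma intR_abs f : intR P f -> intR P (fun w => `|f w|).
Proof. exact: integrable_norm. Qed.

Lemma intR_sum I (s : seq I) (F : I -> T -> R) :
  (forall i, intR P (F i)) -> intR P (fun w => \sum_(i <- s) F i w).
Proof.
move=> Fi; elim: s => [|i s IHs].
  by under eq_fun do rewrite big_nil; exact: intR_cst.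
by under eq_fun do rewrite big_cons; exact: intRD.
Qed.

Lemma intR_measurable f : intR P f -> measurable_fun setT f.
Proof. by move=> /integrableP[mf _]; exact/measurable_EFinP. Qed.

Local Notation E f := (Rintegral P setT f).

Lemma ED f g : intR P f -> intR P g -> E (fun w => f w + g w) = E f + E g.
Proof. by move=> *; rewrite RintegralD. Qed.

Lemma EB f g : intR P f -> intR P g -> E (fun w => f w - g w) = E f - E g.
Proof. by move=> *; rewrite RintegralB. Qed.

Lemma EZ c f : intR P f -> E (fun w => c * f w) = c * E f.
Proof. by move=> *; rewrite RintegralZl. Qed.

Lemma Ecst c : E (fun=> c) = c.
Proof.
by rewrite Rintegral_cst// [X in fine X](_ : _ = 1%E) ?mulr1//; exact: probability_setT.
Qed.

Lemma Esum I (s : seq I) (F : I -> T -> R) : (forall i, intR P (F i)) ->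
  E (fun w => \sum_(i <- s) F i w) = \sum_(i <- s) E (F i).
Proof.
move=> Fi; elim: s => [|i s IHs].
  by under eq_fun do rewrite big_nil; rewrite Ecst big_nil.
under eq_fun do rewrite big_cons.
by rewrite ED// ?IHs ?big_cons//; exact: intR_sum.
Qed.

Lemma Ele f g : intR P f -> intR P g -> (forall w, f w <= g w) -> E f <= E g.
Proof. by move=> fi gi fg; apply: le_Rintegral => // w _; exact: fg. Qed.

Lemma Eabs f : intR P f -> `|E f| <= E (fun w => `|f w|).
Proof. by move=> fi; exact: le_normr_Rintegral. Qed.

(** Taking out what is known, for an integrable Z whose conditional
expectation given G is zero: a is uniformly approximated by G-measurable
functions with finitely many values, and the error costs at most e E|Z|. *)
Lemma E_mul_bounded (G : set (set T)) Z a C : sigma_algebra setT G ->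
  G `<=` @measurable d T -> intR P Z ->
  (forall A, G A -> \int[P]_(w in A) Z w = 0) ->
  gmeas G a -> (forall w, `|a w| <= C) -> E (fun w => a w * Z w) = 0.
Proof.
move=> sG GT Zi Z0 ga aC.
have ma := gmeas_measurable GT ga.
have EZ0 : E Z = 0 by apply: Z0; case: sG => G0 GC _; rewrite -[setT]setD0; exact: GC.
have C0 : 0 <= C by apply: le_trans (aC point).
have aZi := intR_mul ma aC Zi.
have bound e : 0 < e -> `|E (fun w => a w * Z w)| <= e * E (fun w => `|Z w|).
  move=> e0.
  pose q w := (a w + C) / e.
  have q0 w : 0 <= q w.
    by rewrite divr_ge0// ?(ltW e0)//; have := aC w; rewrite ler_norml; lra.
  pose N := (Num.truncn (2 * C / e)).+1.
  have gq : gmeas G q.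
    by apply: measurable_funM => //; apply: measurable_funD => //; exact: measurable_cst.
  pose b l w := (l%:R <= q w) && (q w < l%:R + 1).
  have gb l : gmeas G (b l).
    apply: measurable_and; first by apply: measurable_fun_ler.
    by apply: measurable_fun_ltr.
  pose s w := \sum_(l <- iota 0 N) (l%:R * e) * ((b l w)%:R : R).
  have sE w : s w = (Num.truncn (q w))%:R * e.
    have bE l : b l w = (l == Num.truncn (q w)).
      rewrite /b natr1; apply/idP/eqP => [|->]; last exact: truncn_itv.
      by move=> /truncn_def ->.
    rewrite /s (bigD1_seq (Num.truncn (q w))) ?iota_uniq//; last first.
      rewrite mem_iota leq0n add0n ltnS; apply: le_truncn.
      by rewrite ler_pM2r ?invr_gt0//; have := aC w; rewrite ler_norml; lra.
    rewrite /= bE eqxx mulr1 big1 ?addr0// => l ln.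
    by rewrite bE (negbTE ln) mulr0.
  have as_ w : `|a w - (s w - C)| <= e.
    have := truncn_itv (q0 w); rewrite sE -[_.+1%:R]natr1.
    set n : R := _%:R; rewrite /q ler_pdivlMr// ltr_pdivrMr// mulrDl mul1r.
    by move=> /andP[h1 h2]; rewrite ler_norml; lra.
  have bZi l : intR P (fun w => (l%:R * e) * (((b l w)%:R : R) * Z w)).
    apply: intRZ; apply: (@intR_mul _ _ 1) => //.
      by apply: gmeas_measurable GT _; exact: gmeas_ind.
    by move=> w; case: (b l w); rewrite ?normr1 ?normr0.
  have sZi : intR P (fun w => s w * Z w).
    under eq_fun do rewrite mulr_suml.
    apply: intR_sum => l; under eq_fun do rewrite -mulrA; exact: bZi.
  have EsZ : E (fun w => s w * Z w) = 0.
    under eq_Rintegral do rewrite mulr_suml.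
    rewrite Esum; last by move=> l; under eq_fun do rewrite -mulrA; exact: bZi.
    rewrite big1// => l _; under eq_Rintegral do rewrite -mulrA.
    rewrite EZ; last first.
      apply: (@intR_mul _ _ 1) => //.
        by apply: gmeas_measurable GT _; exact: gmeas_ind.
      by move=> w; case: (b l w); rewrite ?normr1 ?normr0.
    suff -> : E (fun w => (b l w)%:R * Z w) = 0 by rewrite mulr0.
    rewrite -(Z0 _ (gmeas_set sG (gb l))) [RHS]Rintegral_mkcond.
    apply: eq_Rintegral => w _ /=.
    rewrite /restrict; case: ifPn; rewrite ?inE/=; first by move=> ->; rewrite mul1r.
    by move/negP; rewrite inE/= => /negP/negbTE ->; rewrite mul0r.
  have CZi := intRZ C Zi.
  have -> : E (fun w => a w * Z w) = E (fun w => (a w - (s w - C)) * Z w).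
    transitivity (E (fun w => a w * Z w - s w * Z w + C * Z w)).
      rewrite ED//; last exact: intRB.
      by rewrite EB// EsZ EZ// EZ0 mulr0 subr0 addr0.
    by apply: eq_Rintegral => w _; ring.
  have di : intR P (fun w => (a w - (s w - C)) * Z w).
    rewrite (_ : (fun w => _) = (fun w => a w * Z w - s w * Z w + C * Z w)).
      by apply: intRD => //; exact: intRB.
    by apply/funext => w; ring.
  apply: le_trans (Eabs di) _; rewrite -EZ; last exact: intR_abs.
  apply: Ele; [exact: intR_abs|exact/intRZ/intR_abs|move=> w].
  by rewrite normrM ler_wpM2r.
apply/eqP; rewrite -normr_le0; apply/ler_addgt0Pr => e e0; rewrite add0r.
have K0 : 0 <= E (fun w => `|Z w|) by apply: Rintegral_ge0.
have K1 : 0 < E (fun w => `|Z w|) + 1 by lra.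
apply: le_trans (bound (e / (E (fun w => `|Z w|) + 1)) _) _; first exact: divr_gt0.
by rewrite mulrAC ler_pdivrMr// ler_pM2l//; lra.
Qed.

(** Conditional Jensen inequality for the absolute value: pair Y - X with the
sign of X, which is known. *)
Lemma E_abs_le (G : set (set T)) X Y (b : T -> bool) : sigma_algebra setT G ->
  G `<=` @measurable d T -> intR P X -> intR P Y ->
  (forall A, G A -> \int[P]_(w in A) (Y w - X w) = 0) ->
  gmeas G X -> gmeas G b ->
  E (fun w => (b w)%:R * `|X w|) <= E (fun w => (b w)%:R * `|Y w|).
Proof.
move=> sG GT Xi Yi XY gX gb.
pose s w : R := (b w)%:R * (if 0 <= X w then 1 else -1).
have s1 w : `|s w| <= 1.
  by rewrite /s normrM; case: (b w); case: ifP; rewrite ?normrN normr1 ?normr0 ?mulr1.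
have gs : gmeas G s.
  apply: measurable_funM; first exact: gmeas_ind.
  by apply: measurable_fun_ifT => //; apply: measurable_fun_ler.
have ms := gmeas_measurable GT gs.
have b1 w : `|(b w)%:R : R| <= 1 by case: (b w); rewrite ?normr1 ?normr0.
have mb : measurable_fun setT (fun w => (b w)%:R : R).
  by apply: gmeas_measurable GT _; exact: gmeas_ind.
have := E_mul_bounded sG GT (intRB Yi Xi) XY gs s1.
rewrite (_ : Rintegral _ _ _ = E (fun w => s w * Y w) - E (fun w => s w * X w)); last first.
  by rewrite -EB; [|exact: intR_mul s1 _|exact: intR_mul s1 _];
    apply: eq_Rintegral => w _; rewrite mulrBr.
move/eqP; rewrite subr_eq0 => /eqP YX.
rewrite (_ : E (fun w => _ * `|X w|) = E (fun w => s w * Y w)); last first.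
  rewrite YX; apply: eq_Rintegral => w _; rewrite /s -mulrA; congr (_ * _).
  by case: ifPn => [x0|]; [rewrite ger0_norm// mul1r|
    rewrite -ltNge => x0; rewrite ltr0_norm// mulN1r].
apply: Ele; [exact: intR_mul s1 _|exact/(intR_mul mb b1)/intR_abs|move=> w].
apply: le_trans (ler_norm _) _; rewrite normrM ler_wpM2r//.
by rewrite /s normrM; case: (b w); case: ifP; rewrite ?normrN normr1 ?normr0 ?mulr1.
Qed.

End Integrals.

(** * Martingale transforms stopped one step too late *)

Section DiscreteMartingale.
Context {R : realType} {d : measure_display} {T : measurableType d}.
Variable P : probability T R.
Implicit Types (G : nat -> set (set T)) (X : nat -> T -> R).
Local Notation E f := (Rintegral P setT f).

Definition discrete_martingale G X :=
  [/\ forall i, sigma_algebra setT (G i),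
      forall i, G i `<=` @measurable d T,
      forall i j, (i <= j)%N -> G i `<=` G j,
      forall i, gmeas (G i) (X i) &
      (forall i, intR P (X i)) /\
      forall i j A, (i <= j)%N -> G i A -> \int[P]_(w in A) (X j w - X i w) = 0].

Definition jump X (e : R) (n : nat) (w : T) : bool :=
  has (fun i => e < `|X i.+1 w - X i w|) (iota 0 n).

Lemma measurable_jump X e n : (forall i, measurable_fun setT (X i)) ->
  measurable_fun setT (jump X e n).
Proof.
move=> mX; elim: n => [|n IHn]; first exact: measurable_cst.
rewrite (_ : jump X e n.+1 =
  (fun w => jump X e n w || (e < `|X n.+1 w - X n w|))).
  apply: measurable_or => //; apply: measurable_fun_ltr => //.
  by apply: measurableT_comp => //; exact: measurable_funB.
by apply/funext => w; rewrite /jump -addn1 iotaD has_cat/= orbF add0n addn1.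
Qed.

(** Here D i tells that the process is still running at time i, and U i that it
is not frozen just before the step from i to i+1; U i is known at time i+1
only.  Since E[1_D a dX] = 0, the sum of the E[1_U a dX] is minus the sum of the
E[1_(D \ U) a dX], which involves a single step.  If that step is not small, it
is bounded by B + |X_(i+1)|, and |X_(i+1)| may be replaced by the final |X_n|
because |X| is a submartingale and the event is known at time i+1. *)
Lemma transform_bound G X (a : nat -> T -> R) (D U : nat -> T -> bool) n
    (B C e : R) :
  discrete_martingale G X -> 0 <= B -> 0 <= C -> 0 <= e ->
  (forall i, gmeas (G i) (a i)) -> (forall i w, `|a i w| <= C) ->
  (forall i, gmeas (G i) (D i)) -> (forall i, gmeas (G i.+1) (U i)) ->
  (forall i w, U i w -> D i w) ->
  (forall w, \sum_(i <- iota 0 n) (D i w && ~~ U i w)%:R <= 1 :> R) ->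
  (forall i w, D i w -> `|X i w| <= B) ->
  E (fun w => \sum_(i <- iota 0 n) (U i w)%:R * (a i w * (X i.+1 w - X i w))) <=
  C * (e + E (fun w => (jump X e n w)%:R * (B + `|X n w|))).
Proof.
move=> [sG GT Gmon gX [Xi XG]] B0 C0 e0 ga aC gD gU UD DU1 XB.
have mX i := gmeas_measurable (GT i) (gX i).
have ma i := gmeas_measurable (GT i) (ga i).
have b1 (b : bool) : `|b%:R : R| <= 1 by case: b; rewrite ?normr1 ?normr0.
have mD i : measurable_fun setT (fun w => (D i w)%:R : R).
  by apply: gmeas_measurable (GT i) _; exact: gmeas_ind.
have mU i : measurable_fun setT (fun w => (U i w)%:R : R).
  by apply: gmeas_measurable (GT i.+1) _; exact: gmeas_ind.
have gS i (Y : T -> R) : gmeas (G i) Y -> gmeas (G i.+1) Y.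
  exact: (gmeas_sub (Gmon _ _ (leqnSn i))).
have gSb i (Y : T -> bool) : gmeas (G i) Y -> gmeas (G i.+1) Y.
  exact: (gmeas_sub (Gmon _ _ (leqnSn i))).
pose b i w := [&& D i w, ~~ U i w & e < `|X i.+1 w - X i w|].
have gDU i : gmeas (G i.+1) (fun w => D i w && ~~ U i w).
  by apply: measurable_and; [exact: gSb|exact: measurable_neg].
have gb i : gmeas (G i.+1) (b i).
  rewrite (_ : b i = fun w => (D i w && ~~ U i w) && (e < `|X i.+1 w - X i w|)).
    apply: measurable_and => //; apply: measurable_fun_ltr => //.
    apply: measurableT_comp => //; apply: measurable_funB => //.
    exact: gS.
  by apply/funext => w; rewrite /b andbA.
have mDU i : measurable_fun setT (fun w => (D i w && ~~ U i w)%:R : R).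
  by apply: gmeas_measurable (GT i.+1) _; exact: gmeas_ind.
have mb i : measurable_fun setT (fun w => (b i w)%:R : R).
  by apply: gmeas_measurable (GT i.+1) _; exact: gmeas_ind.
have dXi i : intR P (fun w => X i.+1 w - X i w) by exact: intRB.
have adXi i : intR P (fun w => a i w * (X i.+1 w - X i w)).
  exact: intR_mul (aC i) _.
have UadXi i : intR P (fun w => (U i w)%:R * (a i w * (X i.+1 w - X i w))).
  by apply: (@intR_mul _ _ _ _ _ _ 1).
have BXi k : intR P (fun w => B + `|X k w|).
  by apply: intRD; [exact: intR_cst|exact: intR_abs].
have rhsi k i : intR P (fun w => (D i w && ~~ U i w)%:R * e +
    (b i w)%:R * (B + `|X k w|)).
  by apply: intRD; apply: (@intR_mul _ _ _ _ _ _ 1) => //; exact: intR_cst.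
have step i : (i < n)%N ->
    E (fun w => (U i w)%:R * (a i w * (X i.+1 w - X i w))) <=
    C * E (fun w => (D i w && ~~ U i w)%:R * e + (b i w)%:R * (B + `|X n w|)).
  move=> lin.
  have -> : E (fun w => (U i w)%:R * (a i w * (X i.+1 w - X i w))) =
      E (fun w => - ((D i w && ~~ U i w)%:R * (a i w * (X i.+1 w - X i w)))).
    have Dc : forall w, `|(D i w)%:R * a i w| <= C.
      by move=> w; rewrite normrM -[C]mul1r ler_pM.
    have := E_mul_bounded (sG i) (GT i) (dXi i) (fun A => XG i i.+1 A (leqnSn i))
      (measurable_funM (gmeas_ind (gD i)) (ga i)) Dc.
    rewrite (_ : Rintegral _ _ _ = E (fun w =>
      (U i w)%:R * (a i w * (X i.+1 w - X i w)) -
      - ((D i w && ~~ U i w)%:R * (a i w * (X i.+1 w - X i w))))).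
      rewrite EB//; first by move/eqP; rewrite subr_eq0 => /eqP.
      under eq_fun do rewrite -mulN1r; apply: intRZ.
      by apply: (@intR_mul _ _ _ _ _ _ 1).
    apply: eq_Rintegral => w _; rewrite opprK /=.
    have := @UD i w; case: (D i w); case: (U i w) => //=;
      rewrite ?mul0r ?mul1r ?addr0 ?add0r//.
    by move=> /(_ isT).
  apply: le_trans (_ : C * E (fun w => (D i w && ~~ U i w)%:R * e +
      (b i w)%:R * (B + `|X i.+1 w|)) <= _).
    rewrite -EZ//; apply: Ele => //.
    - under eq_fun do rewrite -mulN1r; apply: intRZ.
      by apply: (@intR_mul _ _ _ _ _ _ 1).
    - exact: intRZ.
    move=> w; apply: le_trans (ler_norm _) _; rewrite normrN normrM normrM.
    rewrite mulrCA ler_pM// /b.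
    have [Dw|] := boolP (D i w); last by rewrite !mul0r normr0 mul0r addr0.
    have [|] := boolP (U i w); rewrite /= ?normr0 ?normr1 ?mul0r ?addr0// !mul1r => _.
    have := XB i w Dw; case: ltP => h; rewrite ?mul1r ?mul0r ?addr0// => XiB.
    have := ler_normB (X i.+1 w) (X i w); lra.
  rewrite ler_wpM2l// ED; [|by apply: (@intR_mul _ _ _ _ _ _ 1) => //; exact: intR_cst|by apply: (@intR_mul _ _ _ _ _ _ 1)].
  rewrite ED; [|by apply: (@intR_mul _ _ _ _ _ _ 1) => //; exact: intR_cst|by apply: (@intR_mul _ _ _ _ _ _ 1)].
  rewrite lerD2l.
  (* Only the part with |X| changes between times i+1 and n. *)
  have split_ k : E (fun w => (b i w)%:R * (B + `|X k w|)) =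
      E (fun w => (b i w)%:R * B) + E (fun w => (b i w)%:R * `|X k w|).
    rewrite -ED; first by apply: eq_Rintegral => w _; rewrite mulrDr.
    - by apply: (@intR_mul _ _ _ _ _ _ 1) => //; exact: intR_cst.
    - by apply: (@intR_mul _ _ _ _ _ _ 1) => //; exact: intR_abs.
  rewrite !split_ lerD2l; apply: (E_abs_le (sG i.+1)) => //.
  by move=> A; exact: XG.
rewrite Esum//.
apply: le_trans (_ : \sum_(i <- iota 0 n) C * E (fun w =>
    (D i w && ~~ U i w)%:R * e + (b i w)%:R * (B + `|X n w|)) <= _).
  rewrite big_seq [leRHS]big_seq; apply: ler_sum => i.
  by rewrite mem_iota add0n => /andP[_]; exact: step.
rewrite -mulr_sumr ler_wpM2l// -Esum//.
have mj : measurable_fun setT (fun w => (jump X e n w)%:R : R).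
  rewrite (_ : (fun w => _) = (fun w => if jump X e n w then 1 else 0)).
    by apply: measurable_fun_ifT => //; exact: measurable_jump.
  by apply/funext => w; case: (jump _ _ _ _).
have ji : intR P (fun w => (jump X e n w)%:R * (B + `|X n w|)).
  by apply: (@intR_mul _ _ _ _ _ _ 1).
rewrite -[X in _ <= X + _](@Ecst _ _ _ P e) -ED//; last exact: intR_cst.
apply: Ele; [exact: intR_sum|by apply: intRD => //; exact: intR_cst|move=> w].
rewrite big_split/= -!mulr_suml lerD//.
  by rewrite -[leRHS]mul1r ler_wpM2r.
rewrite ler_wpM2r ?addr_ge0//.
have [jw|] := boolP (jump X e n w).
  apply: le_trans (DU1 w); apply: ler_sum => i _.
  by rewrite /b; case: (D i w) => //=; case: (U i w) => //=; case: (_ < _).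
rewrite /jump -all_predC => /allP nj; rewrite big_seq big1// => i /nj /=.
by rewrite /b => /negbTE ->; rewrite !andbF.
Qed.

End DiscreteMartingale.

(** * The one-step exponential estimate *)

Section ExponentialStep.
Context {R : realType}.
Implicit Types (lam delta eps z : R).

(** From exp (- z) >= 1 - z. *)
Lemma expR_le_quad z : z <= 1 / 2 -> expR z <= 1 + z + 2 * z ^+ 2.
Proof.
move=> z12.
have z1 : 0 < 1 - z by lra.
apply: le_trans (_ : (1 - z)^-1 <= _).
  rewrite -[expR z]invrK lef_pV2 ?posrE ?invr_gt0 ?expR_gt0// -expRN.
  exact: expR_ge1Dx.
rewrite -[(1 - z)^-1]mul1r ler_pdivrMr//.
have : 0 <= z ^+ 2 * (1 - 2 * z) by rewrite mulr_ge0 ?sqr_ge0//; lra.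
rewrite (_ : (1 + z + 2 * z ^+ 2) * (1 - z) = 1 + z ^+ 2 * (1 - 2 * z)); last by ring.
lra.
Qed.

Lemma mul_sqr2_ge0 (c u v : R) : 0 <= c -> 0 <= c * u ^+ 2 * v ^+ 2.
Proof.
by move=> c0; apply: mulr_ge0; [apply: mulr_ge0|]; rewrite ?sqr_ge0.
Qed.

Lemma sqr_le_abs (x y : R) : `|x| <= y -> x ^+ 2 <= y ^+ 2.
Proof.
by move=> xy; rewrite -real_normK ?num_real// ler_pXn2r ?nnegrE// (le_trans _ xy).
Qed.

(** What the one-step estimate requires of eps: the exponent is at most 1/2, and
the error terms in q are absorbed in the excess of mu = 36 lambda^2 delta^2
over 34 lambda^2 delta^2. *)
Definition small_eps lam delta eps :=
  [/\ 0 < eps, eps <= delta / 2,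
      8 * (`|lam| + 36 * lam ^+ 2 * delta ^+ 2) ^+ 2 * eps <=
        2 * lam ^+ 2 * delta ^+ 2 &
      `|lam| * eps * (5 * delta + 1) <= 1 / 2].

Lemma small_epsP lam delta : lam != 0 -> 0 < delta ->
  exists2 e0, 0 < e0 & forall eps, 0 < eps < e0 -> small_eps lam delta eps.
Proof.
move=> lam0 d0.
set A := (`|lam| + 36 * lam ^+ 2 * delta ^+ 2) ^+ 2.
have A0 : 0 <= A by exact: sqr_ge0.
set b := 2 * lam ^+ 2 * delta ^+ 2.
have b0 : 0 < b.
  have l20 : 0 < lam ^+ 2 by rewrite exprn_even_gt0.
  by apply: mulr_gt0; [exact: mulr_gt0|exact: exprn_gt0].
have c0 : 0 < `|lam| * (5 * delta + 1) by rewrite mulr_gt0 ?normr_gt0//; lra.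
set c := `|lam| * (5 * delta + 1) in c0.
exists (Num.min (delta / 2) (Num.min (b / (8 * A + 1)) (1 / 2 / c))).
  rewrite !lt_min !divr_gt0//; lra.
move=> eps; rewrite !lt_min => /andP[e0 /and3P[e1 e2 e3]]; split => //.
- exact: ltW.
- rewrite ltr_pdivlMr in e2; last lra.
  by rewrite -/A -/b; lra.
- rewrite ltr_pdivlMr// in e3.
  by rewrite mulrAC -/c mulrC ltW.
Qed.

(** With h = M - j, x = dM, q = dQ, and e the error made when a lattice step is
recorded (k = true), the increment of V is 2 h x + x^2 - q + e.  The square of
the exponent is dominated by a multiple of lambda^2 delta^2 x^2, and
x^2 = (x^2 - q) + q: the first part is a martingale increment, the second one is
compensated by mu q. *)
Lemma exp_step lam delta eps (h x q e : R) (k : bool) :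
  small_eps lam delta eps -> `|h| <= delta -> `|x| <= eps -> 0 <= q <= eps ->
  `|e| <= 2 * delta * eps * k%:R ->
  expR (lam * (2 * h * x + x ^+ 2 - q + e) - 36 * lam ^+ 2 * delta ^+ 2 * q) <=
  1 + 2 * lam * h * x + (lam + 34 * lam ^+ 2 * delta ^+ 2) * (x ^+ 2 - q)
    + (2 * `|lam| * delta + 16 * lam ^+ 2 * delta ^+ 3) * eps * k%:R.
Proof.
move=> [eps0 epsd s1 s2] hd xe /andP[q0 qe] ek.
have d0 : 0 < delta by lra.
have k01 : 0 <= (k%:R : R) <= 1 by case: (k); rewrite /= ler01 lexx.
have ee : `|e| <= 2 * delta * eps.
  by apply: le_trans ek _; rewrite ler_piMr//; [rewrite !mulr_ge0//; lra|lra].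
set l := `|lam|; have l0 : 0 <= l by exact: normr_ge0.
have lamD u v : `|u| <= v -> lam * u <= l * v.
  move=> uv; apply: le_trans (ler_norm _) _.
  by rewrite normrM ler_wpM2l.
have l2 : lam ^+ 2 = l ^+ 2 by rewrite real_normK// num_real.
set mu := 36 * lam ^+ 2 * delta ^+ 2.
have mu0 : 0 <= mu by exact: mul_sqr2_ge0.
set z := (X in expR X).
have hx : `|h * x| <= delta * eps by rewrite normrM ler_pM.
have x2 : x ^+ 2 <= eps ^+ 2 by exact: sqr_le_abs.
have x20 : 0 <= x ^+ 2 by exact: sqr_ge0.
have eps2 : eps ^+ 2 <= delta * eps by rewrite expr2 ler_pM2r//; lra.
have z12 : z <= 1 / 2.
  apply: le_trans s2; rewrite /z.
  have muq : 0 <= mu * q by rewrite mulr_ge0.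
  apply: le_trans (_ : lam * (2 * h * x + x ^+ 2 - q + e) <= _); first by rewrite gerBl.
  rewrite -[X in _ <= X]mulrA; apply: lamD.
  by move: hx ee; rewrite !ler_norml; lra.
apply: le_trans (expR_le_quad z12) _.
have zE : z = 2 * lam * h * x + lam * x ^+ 2 + lam * e - (lam + mu) * q.
  by rewrite /z; ring.
(* Cauchy-Schwarz for the four terms of the exponent. *)
have sq4 (a b c d' : R) :
    (a + b + c - d') ^+ 2 <= 4 * (a ^+ 2 + b ^+ 2 + c ^+ 2 + d' ^+ 2).
  rewrite -subr_ge0.
  have -> : 4 * (a ^+ 2 + b ^+ 2 + c ^+ 2 + d' ^+ 2) - (a + b + c - d') ^+ 2 =
    (a - b) ^+ 2 + (a - c) ^+ 2 + (a + d') ^+ 2 + (b - c) ^+ 2 + (b + d') ^+ 2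
    + (c + d') ^+ 2 by ring.
  by rewrite !addr_ge0// sqr_ge0.
have z2 := sq4 (2 * lam * h * x) (lam * x ^+ 2) (lam * e) ((lam + mu) * q).
rewrite -zE in z2.
have T1 : (2 * lam * h * x) ^+ 2 <= 4 * lam ^+ 2 * delta ^+ 2 * x ^+ 2.
  rewrite (_ : _ ^+ 2 = 4 * lam ^+ 2 * h ^+ 2 * x ^+ 2); last by ring.
  rewrite ler_wpM2r// ler_wpM2l//; first by rewrite mulr_ge0 ?sqr_ge0.
  exact: sqr_le_abs.
have T2 : 4 * (lam * x ^+ 2) ^+ 2 <= lam ^+ 2 * delta ^+ 2 * x ^+ 2.
  rewrite (_ : _ * _ ^+ 2 = lam ^+ 2 * (4 * x ^+ 2) * x ^+ 2); last by ring.
  rewrite ler_wpM2r// ler_wpM2l ?sqr_ge0//.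
  apply: le_trans (_ : 4 * eps ^+ 2 <= _); first lra.
  have : (2 * eps) ^+ 2 <= delta ^+ 2 by apply: sqr_le_abs; rewrite gtr0_norm; lra.
  by rewrite exprMn; lra.
have T3 : (lam * e) ^+ 2 <= 2 * lam ^+ 2 * delta ^+ 3 * eps * k%:R.
  have -> : (lam * e) ^+ 2 = lam ^+ 2 * (`|e| * `|e|).
    by rewrite -expr2 real_normK ?num_real//; ring.
  have -> : 2 * lam ^+ 2 * delta ^+ 3 * eps * k%:R =
    lam ^+ 2 * (2 * delta * eps * k%:R * (delta * delta)) by ring.
  rewrite ler_wpM2l ?sqr_ge0// ler_pM//.
  apply: le_trans ee _; rewrite mulrAC mulrC ler_pM2l//; lra.
have T4 : 8 * ((lam + mu) * q) ^+ 2 <= 2 * lam ^+ 2 * delta ^+ 2 * q.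
  have lm : `|lam + mu| <= l + mu.
    by apply: le_trans (ler_normD _ _) _; rewrite (ger0_norm mu0).
  apply: le_trans (_ : 8 * (l + mu) ^+ 2 * eps * q <= _); last exact: ler_wpM2r.
  have A2 : q ^+ 2 <= eps * q by rewrite expr2 ler_wpM2r.
  have := ler_pM (sqr_ge0 (lam + mu)) (sqr_ge0 q) (sqr_le_abs lm) A2.
  rewrite exprMn; lra.
have lame : lam * e <= l * (2 * delta * eps * k%:R).
  exact: lamD.
move: z2 T1 T2 T3 T4 lame; rewrite zE /mu; lra.
Qed.

End ExponentialStep.

(** * The exponential inequality on a grid *)

Section ExponentialInequality.
Context {R : realType} {d : measure_display} {T : measurableType d}.
Variable P : probability T R.
Variables (G : nat -> set (set T)) (X Y : nat -> T -> R).
Variables (delta eps lam y L B : R).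
Local Notation E f := (Rintegral P setT f).

Let Q i w := X i w ^+ 2 - Y i w.
Let J i w := hlevel delta eps (X ^~ w) i.
Let K i w := hcount delta eps (X ^~ w) i.

(** The process V on the grid. *)
Definition excess i w := (X i w - J i w) ^+ 2 + delta ^+ 2 * K i w - Q i w.

Definition level_ok i w := [&& `|X i w| <= B, 0 <= Q i w, Q i w <= L,
  K i w <= B & `|X i w - J i w| <= delta].

Definition step_ok i w := [&& `|X i.+1 w - X i w| <= eps,
  0 <= Q i.+1 w - Q i w & Q i.+1 w - Q i w <= eps].

Definition expo i w := 
  expR (lam * excess i w - 36 * lam ^+ 2 * delta ^+ 2 * Q i w).

(** The computation runs as long as the levels are bounded, the exponent is
below y and the steps are small.  Starting at 0 is part of the condition, as
the martingales vanish at time 0 only almost surely. *)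
Fixpoint alive i w := level_ok i w && (lam * excess i w < y) &&
  (if i is i'.+1 then alive i' w && step_ok i' w
   else (X 0 w == 0) && (Y 0 w == 0)).

Fixpoint stopped_expo i w :=
  if i is i'.+1 then
    if alive i' w && step_ok i' w then expo i w else stopped_expo i' w
  else 1.

Let Phi := expo.
Let Psi := stopped_expo.

Lemma alive0 w : alive 0 w =
  level_ok 0 w && (lam * excess 0 w < y) && ((X 0 w == 0) && (Y 0 w == 0)).
Proof. by []. Qed.

Lemma aliveS i w : alive i.+1 w =
  level_ok i.+1 w && (lam * excess i.+1 w < y) && (alive i w && step_ok i w).
Proof. by []. Qed.

Lemma stopped_expoS i w : stopped_expo i.+1 w =
  if alive i w && step_ok i w then expo i.+1 w else stopped_expo i w.
Proof. by []. Qed.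

Lemma alive_expo i w : alive i w -> Psi i w = Phi i w.
Proof.
case: i => [|i]; last by rewrite aliveS /Psi stopped_expoS => /andP[_ ->].
rewrite alive0 => /andP[_ /andP[/eqP X0 /eqP Y0]].
by rewrite /Phi /expo /excess /Q X0 Y0 /J /K /= !(subr0, expr0n, mulr0, addr0)/= expR0.
Qed.

(** If lambda V reaches y while everything else is under control, the process is
frozen from that time on, at a value at least exp (y - mu L). *)
Lemma stopped_expo_hit i n w : (i <= n)%N -> X 0 w = 0 -> Y 0 w = 0 -> 0 < y ->
  (forall j, (j <= i)%N -> level_ok j w) ->
  (forall j, (j < i)%N -> step_ok j w) -> y <= lam * excess i w ->
  expR (y - 36 * lam ^+ 2 * delta ^+ 2 * L) <= Psi n w.
Proof.
move=> in_ X0 Y0 y0 lv st yi.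
have exi : exists i, y <= lam * excess i w by exists i.
case: (ex_minnP exi) => j yj jmin.
have ji : (j <= i)%N by exact: jmin.
have below l : (l < j)%N -> lam * excess l w < y.
  by move=> lj; rewrite ltNge; apply/negP => yl; have := jmin _ yl; rewrite leqNgt lj.
have al l : (l < j)%N -> alive l w.
  elim: l => [|l IHl] lj; last first.
    have lj' : (l < j)%N by exact: ltnW.
    have li : (l < i)%N by exact: leq_trans lj' ji.
    by rewrite aliveS lv ?below ?IHl ?st.
  by rewrite alive0 lv// X0 Y0 !eqxx below.
case: j => [|j] in yj {below} jmin ji al *.
  have := yj; rewrite /excess /Q X0 Y0 /J /K /= !(subr0, expr0n, mulr0, addr0)/=.
  by rewrite leNgt y0.
have Pj : Psi j.+1 w = Phi j.+1 w.
  by rewrite /Psi stopped_expoS al// st// (leq_trans _ ji).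
have dead l : (j < l)%N -> alive l w = false.
  elim: l => // l IHl; rewrite ltnS leq_eqVlt => /predU1P[<-|jl].
    by rewrite aliveS ltNge yj andbF.
  by rewrite aliveS IHl//= andbF.
have PE l : (j < l)%N -> Psi l w = Phi j.+1 w.
  elim: l => // l IHl; rewrite ltnS leq_eqVlt => /predU1P[<-//|jl].
  by rewrite -(IHl jl) /Psi stopped_expoS dead.
rewrite PE ?(leq_trans ji)// /Phi /expo ler_expR lerB//.
have /and5P[_ _ QL _ _] := lv j.+1 ji.
by rewrite ler_wpM2l// mul_sqr2_ge0.
Qed.

Hypothesis small : small_eps lam delta eps.
Hypothesis B0 : 0 <= B.
Hypothesis L0 : 0 <= L.

Let c := 34 * lam ^+ 2 * delta ^+ 2.
Let g0 := 2 * `|lam| * delta + 16 * lam ^+ 2 * delta ^+ 3.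
Let U i w := alive i w && step_ok i w.

Lemma hcount_step i w : exists b : bool, K i.+1 w = K i w + b%:R.
Proof. by eexists. Qed.

(** When a step is recorded, |X_(i+1) - j| is within eps of delta, and moving j
by delta towards X_(i+1) changes V by 2 delta (delta - |X_(i+1) - j|). *)
Lemma excess_step i w : `|X i w - J i w| <= delta -> step_ok i w ->
  exists b : bool, exists e, [/\ K i.+1 w = K i w + b%:R,
   `|e| <= 2 * delta * eps * b%:R &
   excess i.+1 w - excess i w =
     2 * (X i w - J i w) * (X i.+1 w - X i w) + (X i.+1 w - X i w) ^+ 2
     - (Q i.+1 w - Q i w) + e].
Proof.
have [eps0 epsd _ _] := small.
move=> hd /and3P[dX _ _]; rewrite /excess.
have [JE KE] : J i.+1 w = (if delta - eps <= `|X i.+1 w - J i w| then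
      if J i w <= X i.+1 w then J i w + delta else J i w - delta
    else J i w) /\ K i.+1 w = K i w + (delta - eps <= `|X i.+1 w - J i w|)%R%:R.
  by [].
rewrite KE; exists (delta - eps <= `|X i.+1 w - J i w|).
have [cr|ncr] := boolP (delta - eps <= `|X i.+1 w - J i w|); last first.
  rewrite (negbTE ncr) in JE; exists 0; rewrite !mulr0 normr0; split => //.
  by rewrite JE addr0; ring.
rewrite cr in JE; exists (2 * delta * (delta - `|X i.+1 w - J i w|)).
have XJ : `|X i.+1 w - J i w| <= delta + eps.
  rewrite -[X in `|X|](subrKA (X i w)) (le_trans (ler_normD _ _))//.
  by rewrite addrC lerD.
split => //.
  rewrite mulr1 normrM [`|2 * delta|]ger0_norm; last lra.
  by rewrite ler_pM2l; [rewrite ler_norml; lra|lra].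
have t1 : true%:R = 1 :> R by []; rewrite JE t1; have [JX|XJ'] := leP (J i w) (X i.+1 w).
  by rewrite ger0_norm ?subr_ge0//; ring.
by rewrite ltr0_norm ?subr_lt0//; ring.
Qed.

Definition coefX i w : R := (alive i w)%:R *
  (Phi i w * (2 * lam * (X i w - J i w) - 2 * (lam + c) * X i w)).
Definition coefY i w : R := (alive i w)%:R * (Phi i w * (lam + c)).
Definition coef_bound := expR y *
  (2 * `|lam| * delta + 2 * (`|lam| + c) * B + (`|lam| + c)).

Let c_ge0 : 0 <= c. Proof. exact: mul_sqr2_ge0. Qed.

Let delta_ge0 : 0 <= delta.
Proof. by have [] := small; lra. Qed.

Let g0_ge0 : 0 <= g0.
Proof.
apply: addr_ge0; first by rewrite !mulr_ge0.
by rewrite mulr_ge0 ?exprn_ge0// mulr_ge0 ?sqr_ge0.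
Qed.

Lemma alive_level i w : alive i w -> level_ok i w /\ lam * excess i w < y.
Proof. by case: i => [|i]; rewrite ?alive0 ?aliveS => /andP[/andP[]]. Qed.

Lemma alive_expo_le i w : alive i w -> Phi i w <= expR y.
Proof.
move=> /alive_level[/and5P[_ Q0 _ _ _] Vy]; rewrite /Phi /expo ler_expR.
have : 0 <= 36 * lam ^+ 2 * delta ^+ 2 * Q i w by rewrite mulr_ge0// mul_sqr2_ge0.
rewrite /Q; lra.
Qed.

Let lc_ge0 : 0 <= `|lam| + c. Proof. by rewrite addr_ge0. Qed.

Lemma coef_bound_ge0 : 0 <= coef_bound.
Proof.
apply: mulr_ge0; first exact: expR_ge0.
apply: addr_ge0 => //; apply: addr_ge0; apply: mulr_ge0 => //; exact: mulr_ge0.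
Qed.

Lemma coefX_bound i w : `|coefX i w| <= coef_bound.
Proof.
have C0 := coef_bound_ge0.
rewrite /coefX; have [al|_] := boolP (alive i w); last by rewrite mul0r normr0.
have [/and5P[XB _ _ _ hd] _] := alive_level al.
rewrite mul1r normrM ger0_norm ?expR_ge0// ler_pM ?expR_ge0//.
  exact: alive_expo_le.
have n2 : `|2| = 2 :> R by rewrite ger0_norm.
apply: le_trans (ler_normB _ _) _.
rewrite !normrM !n2 -[X in X <= _]addr0 lerD// lerD//.
  by rewrite ler_wpM2l// mulr_ge0.
apply: ler_pM => //.
by rewrite ler_wpM2l// (le_trans (ler_normD _ _))// (ger0_norm c_ge0).
Qed.

Lemma coefY_bound i w : `|coefY i w| <= coef_bound.
Proof.
have C0 := coef_bound_ge0.
rewrite /coefY; have [al|_] := boolP (alive i w); last by rewrite mul0r normr0.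
rewrite mul1r normrM ger0_norm ?expR_ge0// ler_pM ?expR_ge0//.
  exact: alive_expo_le.
rewrite (le_trans (ler_normD _ _))// (ger0_norm c_ge0) lerDr.
by apply: addr_ge0; apply: mulr_ge0 => //; exact: mulr_ge0.
Qed.

Lemma expo_step i w : U i w -> Phi i.+1 w <= Phi i w
  + coefX i w * (X i.+1 w - X i w) + coefY i w * (Y i.+1 w - Y i w)
  + g0 * eps * expR y * (K i.+1 w - K i w).
Proof.
move=> /andP[al st]; rewrite /coefX /coefY al !mul1r.
have [/and5P[XB _ _ _ hd] _] := alive_level al.
have [b [e [KE eb VE]]] := excess_step hd st.
have := st => /and3P[dX dQ0 dQe].
have := exp_step small hd dX (q := Q i.+1 w - Q i w) (e := e) (k := b).
rewrite dQ0 dQe => /(_ isT eb).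
set z := (X in expR X) => Hz.
have -> : Phi i.+1 w = Phi i w * expR z.
  by rewrite /Phi /expo -expRD /z -VE; congr expR; ring.
have Phi0 : 0 <= Phi i w by exact: expR_ge0.
apply: le_trans (ler_wpM2l Phi0 Hz) _.
have Phiy := alive_expo_le al.
have b0 : 0 <= g0 * eps * b%:R :> R.
  by rewrite !mulr_ge0//; have [] := small; lra.
have := ler_wpM2r b0 Phiy.
rewrite KE /Q /g0 -/c; move: (Phi i w) (expR y) => p ey; lra.
Qed.

(** Sum the one-step estimates.  At most B + 1 lattice steps are recorded while
the computation runs, which bounds the accumulated error. *)
Lemma stopped_expo_le n w : Psi n w <= 1
  + \sum_(i <- iota 0 n) (U i w)%:R * (coefX i w * (X i.+1 w - X i w))
  + \sum_(i <- iota 0 n) (U i w)%:R * (coefY i w * (Y i.+1 w - Y i w))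
  + g0 * eps * expR y * (B + 1).
Proof.
pose S k := \sum_(i <- iota 0 k) (U i w)%:R * (K i.+1 w - K i w).
have SE k (f : nat -> R) : \sum_(i <- iota 0 k.+1) f i = \sum_(i <- iota 0 k) f i + f k.
  by rewrite -addn1 iotaD big_cat/= big_seq1 add0n.
have SB k : (alive k w -> S k <= K k w) /\ S k <= B + 1.
  elim: k => [|k [IH1 IH2]].
    by rewrite /S big_nil; split=> [_|]; rewrite ?lexx// addr_ge0.
  rewrite /S SE -/(S k); have [b KE] := hcount_step k w.
  have b01 : 0 <= (b%:R : R) <= 1 by case: (b); rewrite /= ler01 lexx.
  rewrite aliveS -/(U k w); have [Uk|_] := boolP (U k w); last first.
    by rewrite andbF mul0r addr0.
  have /andP[al _] := Uk; have [/and5P[_ _ _ KB _] _] := alive_level al.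
  by have := IH1 al; rewrite mul1r KE; split=> [_|]; lra.
have main : Psi n w <= 1
  + \sum_(i <- iota 0 n) (U i w)%:R * (coefX i w * (X i.+1 w - X i w))
  + \sum_(i <- iota 0 n) (U i w)%:R * (coefY i w * (Y i.+1 w - Y i w))
  + g0 * eps * expR y * S n.
  elim: n => [|n IHn].
    by rewrite /S !big_nil /Psi/= mulr0 !addr0.
  rewrite /S !SE -/(S n) /Psi stopped_expoS -/(U n w).
  have [Un|_] := boolP (U n w); last by rewrite !mul0r !addr0.
  have /andP[al _] := Un; move: IHn; rewrite (alive_expo al) => IHn.
  by have := expo_step Un; rewrite /Phi in IHn *; rewrite !mul1r; lra.
apply: le_trans main _; rewrite lerD2l ler_wpM2l//; last exact: (SB n).2.
by rewrite !mulr_ge0 ?expR_ge0//; have [] := small; lra.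
Qed.

Hypothesis mX : discrete_martingale P G X.
Hypothesis mY : discrete_martingale P G Y.

Let gX i : gmeas (G i) (X i). Proof. by have [] := mX. Qed.
Let gY i : gmeas (G i) (Y i). Proof. by have [] := mY. Qed.
Let GS i : G i `<=` G i.+1. Proof. by have [_ _ + _ _] := mY; apply. Qed.
Let gS i (f : T -> R) : gmeas (G i) f -> gmeas (G i.+1) f.
Proof. exact: (gmeas_sub (@GS i)). Qed.
Let gSb i (f : T -> bool) : gmeas (G i) f -> gmeas (G i.+1) f.
Proof. exact: (gmeas_sub (@GS i)). Qed.

Lemma gmeas_hlevel i : gmeas (G i) (J i).
Proof.
elim: i => [|i IHi]; first exact: measurable_cst.
have gJ := gS IHi.
rewrite [J i.+1](_ : _ = fun w => if delta - eps <= `|X i.+1 w - J i w| then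
  if J i w <= X i.+1 w then J i w + delta else J i w - delta else J i w)//.
apply: measurable_fun_ifT => //.
  apply: measurable_fun_ler => //; apply: measurableT_comp => //.
  exact: measurable_funB.
apply: measurable_fun_ifT.
- exact: measurable_fun_ler.
- exact: measurable_funD.
- exact: measurable_funB.
Qed.

Lemma gmeas_hcount i : gmeas (G i) (K i).
Proof.
elim: i => [|i IHi]; first exact: measurable_cst.
have gJ := gS (@gmeas_hlevel i); have gK := gS IHi.
apply: measurable_funD => //; apply: gmeas_ind.
apply: measurable_fun_ler => //; apply: measurableT_comp => //.
exact: measurable_funB.
Qed.

Let gQ i : gmeas (G i) (Q i).
Proof. by apply: measurable_funB => //; exact: measurable_funX. Qed.

Lemma gmeas_excess i : gmeas (G i) (excess i).
Proof.
apply: measurable_funB => //; apply: measurable_funD.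
  by apply: measurable_funX; apply: measurable_funB => //; exact: gmeas_hlevel.
by apply: measurable_funM => //; exact: gmeas_hcount.
Qed.

Lemma gmeas_expo i : gmeas (G i) (Phi i).
Proof.
apply: measurableT_comp => //; apply: measurable_funB.
  by apply: measurable_funM => //; exact: gmeas_excess.
exact: measurable_funM.
Qed.

Lemma gmeas_level i : gmeas (G i) (level_ok i).
Proof.
have gJ := @gmeas_hlevel i; have gK := @gmeas_hcount i.
apply: measurable_and; first by apply: measurable_fun_ler => //; exact: measurableT_comp.
apply: measurable_and; first exact: measurable_fun_ler.
apply: measurable_and; first exact: measurable_fun_ler.
apply: measurable_and; first exact: measurable_fun_ler.
apply: measurable_fun_ler => //; apply: measurableT_comp => //.
exact: measurable_funB.
Qed.

Lemma gmeas_step i : gmeas (G i.+1) (step_ok i).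
Proof.
have := gS (@gX i); have := gS (@gQ i) => gQ' gX'.
apply: measurable_and.
  apply: measurable_fun_ler => //; apply: measurableT_comp => //.
  exact: measurable_funB.
apply: measurable_and; apply: measurable_fun_ler => //; exact: measurable_funB.
Qed.

Lemma gmeas_alive i : gmeas (G i) (alive i).
Proof.
have gl k : gmeas (G k) (fun w => level_ok k w && (lam * excess k w < y)).
  apply: measurable_and; first exact: gmeas_level.
  apply: measurable_fun_ltr => //; apply: measurable_funM => //.
  exact: gmeas_excess.
elim: i => [|i IHi]; apply: measurable_and; rewrite ?gl//.
  by apply: measurable_and; apply: measurable_fun_eqr.
by apply: measurable_and; [exact: gSb|exact: gmeas_step].
Qed.

Lemma gmeas_stopped_expo i : gmeas (G i) (Psi i).
Proof.
elim: i => [|i IHi]; first exact: measurable_cst.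
rewrite [Psi i.+1](_ : _ = fun w => if U i w then Phi i.+1 w else Psi i w)//.
apply: measurable_fun_ifT.
- by apply: measurable_and; [exact: gSb (@gmeas_alive i)|exact: gmeas_step].
- exact: gmeas_expo.
- exact: gS.
Qed.

(** Markov's inequality for the frozen exponential process. *)
Lemma stopped_expo_prob (n : nat) (M r : R) : 0 < M -> 0 <= r ->
  (P [set w | (M <= Psi n w)%R] <= ((1
    + coef_bound * (r + E (fun w => (jump X r n w)%:R * (B + `|X n w|)))
    + coef_bound * (r + E (fun w => (jump Y r n w)%:R * (B ^+ 2 + L + `|Y n w|)))
    + g0 * eps * expR y * (B + 1)) / M)%:E)%E.
Proof.
move=> M0 r0.
have [sG GT Gmon _ [Xi _]] := mX; have [_ _ _ _ [Yi _]] := mY.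
have C0 := coef_bound_ge0.
have gU i : gmeas (G i.+1) (U i).
  by apply: measurable_and; [exact: gSb (@gmeas_alive i)|exact: gmeas_step].
have galR i : gmeas (G i) (fun w => (alive i w)%:R : R).
  exact: gmeas_ind (@gmeas_alive i).
have gcX i : gmeas (G i) (coefX i).
  apply: measurable_funM => //; apply: measurable_funM; first exact: gmeas_expo.
  apply: measurable_funB; apply: measurable_funM => //.
  by apply: measurable_funB => //; exact: gmeas_hlevel.
have gcY i : gmeas (G i) (coefY i).
  apply: measurable_funM => //; apply: measurable_funM => //; exact: gmeas_expo.
have DU1 w : \sum_(i <- iota 0 n) (alive i w && ~~ U i w)%:R <= 1 :> R.
  have : (alive n w -> \sum_(i <- iota 0 n) (alive i w && ~~ U i w)%:R = 0 :> R) /\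
     \sum_(i <- iota 0 n) (alive i w && ~~ U i w)%:R <= 1 :> R; last by case.
  elim: n => [|k [IH1 IH2]]; first by rewrite big_nil.
  rewrite -addn1 iotaD big_cat/= big_seq1 add0n addn1 aliveS -/(U k w).
  have [Uk|_] := boolP (U k w); rewrite ?andbF ?andbT ?addr0//.
    by have /andP[al _] := Uk; split => // _; exact: IH1.
  split => //; have [/IH1 ->|_] := boolP (alive k w); rewrite ?add0r ?addr0//.
have UD i w : U i w -> alive i w by move=> /andP[].
have tX := transform_bound mX B0 C0 r0 gcX coefX_bound (@gmeas_alive) gU UD DU1
  (fun i w al => (andP (alive_level al).1).1).
have B2 : 0 <= B ^+ 2 + L by rewrite addr_ge0 ?sqr_ge0.
have YB i w : alive i w -> `|Y i w| <= B ^+ 2 + L.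
  move=> /alive_level[/and5P[XB Q0 QL _ _] _].
  have : X i w ^+ 2 <= B ^+ 2 by exact: sqr_le_abs.
  have := sqr_ge0 (X i w); rewrite ler_norml; move: Q0 QL; rewrite /Q; lra.
have tY := transform_bound mY B2 C0 r0 gcY coefY_bound (@gmeas_alive) gU UD DU1 YB.
have b1 (b : bool) : `|b%:R : R| <= 1 by case: b; rewrite ?normr1 ?normr0.
have sumi (a Z : nat -> T -> R) : (forall i, gmeas (G i) (a i)) ->
    (forall i w, `|a i w| <= coef_bound) -> (forall i, intR P (Z i)) ->
    intR P (fun w => \sum_(i <- iota 0 n) (U i w)%:R * (a i w * (Z i.+1 w - Z i w))).
  move=> ga aC Zi; apply: intR_sum => i; apply: (@intR_mul _ _ _ _ _ _ 1) => //.
    by apply: gmeas_measurable (GT i.+1) _; exact: gmeas_ind.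
  by apply: (intR_mul _ (aC i)); [exact: gmeas_measurable (GT i) _|exact: intRB].
have siX := sumi _ _ gcX coefX_bound Xi.
have siY := sumi _ _ gcY coefY_bound Yi.
have gM : gmeas (G n) (fun w => M <= Psi n w).
  by apply: measurable_fun_ler => //; exact: gmeas_stopped_expo.
have mM : measurable [set w | M <= Psi n w].
  by apply: (GT n); exact: gmeas_set.
have iM : intR P (fun w => (M <= Psi n w)%R%:R).
  apply: (@intR_bounded _ _ _ _ _ 1) => //.
  by apply: gmeas_measurable (GT n) _; exact: gmeas_ind.
have EM : P [set w | M <= Psi n w] = (E (fun w => (M <= Psi n w)%R%:R))%:E.
  rewrite /Rintegral fineK; last exact: integrable_fin_num.
  rewrite -[in LHS](setIT [set w | M <= Psi n w]) -integral_indic//.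
  apply: eq_integral => w _; rewrite indicE; congr ((nat_of_bool _)%:R%:E).
  by apply/idP/idP; rewrite inE.
rewrite EM lee_fin ler_pdivlMr// mulrC -EZ//.
pose f w := 1 + \sum_(i <- iota 0 n) (U i w)%:R * (coefX i w * (X i.+1 w - X i w))
  + \sum_(i <- iota 0 n) (U i w)%:R * (coefY i w * (Y i.+1 w - Y i w))
  + g0 * eps * expR y * (B + 1).
have fi : intR P f.
  apply: intRD; last exact: intR_cst.
  by apply: intRD => //; apply: intRD => //; exact: intR_cst.
apply: le_trans (_ : E f <= _).
  apply: Ele => //; first exact: intRZ.
  move=> w; apply: le_trans (_ : Psi n w <= _); last exact: stopped_expo_le.
  have [MP|_] := leP M (Psi n w); [by rewrite mulr1|rewrite mulr0].
  by elim: (n) => [|k IHk]; rewrite /Psi ?ler01// stopped_expoS; case: ifP => // _; exact: expR_ge0.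
rewrite /f ED//; [|by apply: intRD => //; apply: intRD => //; exact: intR_cst|exact: intR_cst].
rewrite ED//; last by apply: intRD => //; exact: intR_cst.
by rewrite ED ?Ecst//; [rewrite !lerD|exact: intR_cst].
Qed.

End ExponentialInequality.

(** * Refining the grid *)

Section GridLimit.
Context {R : realType} {d : measure_display} {T : measurableType d}.
Variable P : probability T R.
Implicit Types (F : R -> set (set T)) (M Q X Y : R -> T -> R).
Local Notation E f := (Rintegral P setT f).

Definition grid X (eta : R) (i : nat) (w : T) : R := X (i%:R * eta) w.

Lemma grid_martingale F X (eta : R) : filtration F -> martingale P F X ->
  0 <= eta -> discrete_martingale P (fun i => F (i%:R * eta)) (grid X eta).
Proof.
move=> [sF FT Fmon] [aX Xi XE] eta0.
have i0 i : 0 <= i%:R * eta by rewrite mulr_ge0.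
have ij i j : (i <= j)%N -> i%:R * eta <= j%:R * eta.
  by move=> ij; rewrite ler_wpM2r// ler_nat.
split => [i|i|i j lij|i|].
- exact: sF.
- exact: FT.
- by apply: Fmon => //; exact: ij.
- exact: adapted_gmeas.
- split => [i|i j A lij FA]; first exact: Xi.
  have mA : measurable A by exact: FT FA.
  rewrite RintegralB//; [|exact: integrableS (Xi _ (i0 j))|exact: integrableS (Xi _ (i0 i))].
  by rewrite /Rintegral (XE (i%:R * eta) (j%:R * eta)) ?subrr//; exact: ij.
Qed.

Lemma inv_lt_near (r : R) : 0 < r -> \forall n \near \oo, (n.+1%:R : R)^-1 < r.
Proof.
move=> r0; near=> n.
rewrite -[r]invrK ltf_pV2 ?posrE ?invr_gt0//; near: n.
exists (Num.bound r^-1) => // n /= rn.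
apply: lt_le_trans (archi_boundP _) _; first by rewrite invr_ge0 ltW.
by rewrite ler_nat leqW.
Unshelve. all: by end_near. Qed.

(** By uniform continuity of the paths and dominated convergence. *)
Lemma jump_vanish F X (K : nat) (B r : R) : filtration F -> martingale P F X ->
  {ae P, forall w, unif_path (X ^~ w)} -> 0 < r -> 0 <= B ->
  E (fun w => (jump (grid X n.+1%:R^-1) r (K * n.+1) w)%:R * (B + `|X K%:R w|))
    @[n --> \oo] --> (0 : R).
Proof.
move=> fF mX uX r0 B0.
have [sF FT Fmon] := fF; have [aX Xi XE] := mX.
have mXt t : 0 <= t -> measurable_fun setT (X t) by move=> t0; exact: intR_measurable (Xi t t0).
have mjump n : measurable_fun setT (jump (grid X n.+1%:R^-1) r (K * n.+1)).
  by apply: measurable_jump => i; apply: mXt; rewrite mulr_ge0.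
have mjumpR n : measurable_fun setT (fun w => (jump (grid X n.+1%:R^-1) r (K * n.+1) w)%:R : R).
  rewrite (_ : (fun w => _) = (fun w => if jump (grid X n.+1%:R^-1) r (K * n.+1) w then 1 else 0)).
    exact: measurable_fun_ifT.
  by apply/funext => w; case: (jump _ _ _ _).
have gi : intR P (fun w => B + `|X K%:R w|).
  by apply: intRD; [exact: intR_cst|exact/intR_abs/Xi].
have mg := intR_measurable gi.
have [] := @dominated_convergence _ _ _ P setT measurableT
  (fun n w => ((jump (grid X n.+1%:R^-1) r (K * n.+1) w)%:R * (B + `|X K%:R w|))%:E)
  (fun=> 0%E) (fun w => (B + `|X K%:R w|)%:E) _ _ _ gi _.
- by move=> n; apply/measurable_EFinP; exact: measurable_funM.
- exact: measurable_cst.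
- apply: filterS uX => w uw _.
  have [dd dd0 Hd] := uw K%:R r r0.
  apply/cvg_ballP => e e0.
  near=> n.
  have -> : jump (grid X n.+1%:R^-1) r (K * n.+1) w = false.
    apply/negbTE; rewrite /jump -all_predC; apply/allP => i.
    rewrite mem_iota add0n => /andP[_ iK] /=; rewrite -leNgt ltW// /grid.
    apply: Hd.
    - rewrite mulr_ge0//= ler_pdivrMr//.
      by rewrite -natrM ler_nat ltnW.
    - by rewrite mulr_ge0.
    - rewrite -mulrBl -natrB// subSnn mul1r ger0_norm//.
      by near: n; exact: inv_lt_near.
  by rewrite mul0r; exact: ballxx.
- apply: aeW => w n _ /=; rewrite lee_fin normrM (ger0_norm (addr_ge0 _ _))//.
  by rewrite ler_piMl ?addr_ge0//; case: (jump _ _ _ _); rewrite ?normr1 ?normr0.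
move=> _ _; rewrite integral0 => cv.
rewrite [X in X @ _ --> _](_ : _ = fine \o (fun n => \int[P]_w
  ((jump (grid X n.+1%:R^-1) r (K * n.+1) w)%:R * (B + `|X K%:R w|))%:E)%E)//.
exact: fine_cvg.
Unshelve. all: by end_near. Qed.

End GridLimit.

Section StoppedPaths.
Context {R : realType} {d : measure_display} {T : measurableType d}.
Implicit Types (X : R -> T -> R) (S : T -> \bar R).

Lemma stopped_before X S (t : R) w : (t%:E <= S w)%E -> stopped X S t w = X t w.
Proof. by move=> tS; rewrite /stopped; rewrite min_l. Qed.

(** The clock stopped at s neither runs ahead of time nor faster than time, so
that stopped paths inherit the modulus of continuity. *)
Lemma stop_lipschitz (s : \bar R) : (0 <= s)%E ->
  (forall t : R, 0 <= t -> 0 <= fine (Order.min t%:E s) <= t) /\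
  (forall t u : R, `|fine (Order.min t%:E s) - fine (Order.min u%:E s)| <= `|t - u|).
Proof.
case: s => [s| |] //; rewrite ?lee_fin => s0; split.
- by move=> t t0; rewrite -EFin_min/= ge_min lexx le_min t0 s0.
- move=> t u; rewrite -!EFin_min/=; rewrite /Num.min.
  case: (ltP t s) => ts; case: (ltP u s) => us; rewrite ?subrr ?normr_ge0//;
    by have := ler_norm (t - u); have := ler_norm (u - t); rewrite distrC ler_norml; lra.
- by move=> t t0; rewrite min_l ?leey//= t0 lexx.
- by move=> t u; rewrite !min_l ?leey.
Qed.

Lemma unif_path_stopped X S w : (0 <= S w)%E -> unif_path (X ^~ w) ->
  unif_path (stopped X S ^~ w).
Proof.
move=> S0 uX t e e0; have [dd dd0 Hd] := uX t e e0; exists dd => // s u st u0 us.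
have [H1 H2] := stop_lipschitz S0; rewrite /stopped.
have /andP[s0 st'] := st; have /andP[h1 h2] := H1 s s0; have /andP[h3 h4] := H1 u u0.
apply: Hd => //; first by rewrite h1 (le_trans h2).
exact: le_lt_trans (H2 u s) us.
Qed.

End StoppedPaths.

Section ExceedLimit.
Context {R : realType} {d : measure_display} {T : measurableType d}.
Variable P : probability T R.
Variables (F : R -> set (set T)) (X Y : R -> T -> R).
Variables (delta lam y L B : R) (K : nat).
Local Notation E f := (Rintegral P setT f).

(** Choose eps so that the errors at recorded lattice steps total at most 1/4,
then eta so that the two martingale terms contribute at most 1/2. *)
Lemma grid_exceed_prob : filtration F -> martingale P F X -> martingale P F Y ->
  {ae P, forall w, unif_path (X ^~ w)} -> {ae P, forall w, unif_path (Y ^~ w)} ->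
  0 < delta -> lam != 0 -> 0 <= L -> 0 <= B ->
  exists2 e0 : R, 0 < e0 & forall eps : R, 0 < eps < e0 ->
  \forall n \near \oo, let eta := (n.+1%:R : R)^-1 in
   (P [set w | (expR (y - 36 * lam ^+ 2 * delta ^+ 2 * L) <=
        stopped_expo (grid X eta) (grid Y eta) delta eps lam y L B (K * n.+1) w)%R]
    <= (2 * expR (- y + 36 * lam ^+ 2 * delta ^+ 2 * L))%:E)%E.
Proof.
move=> fF mX mY uX uY d0 lam0 L0 B0.
have [e1 e10 He1] := small_epsP lam0 d0.
set g0 := 2 * `|lam| * delta + 16 * lam ^+ 2 * delta ^+ 3.
have g00 : 0 <= g0.
  apply: addr_ge0; first by rewrite !mulr_ge0// ltW.
  by rewrite mulr_ge0 ?exprn_ge0 ?(ltW d0)// mulr_ge0 ?sqr_ge0.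
pose A := g0 * expR y * (B + 1).
have A0 : 0 <= A by rewrite !mulr_ge0 ?expR_ge0// addr_ge0.
exists (Num.min e1 (1 / 4 / (A + 1))).
  by rewrite lt_min e10 divr_gt0//; lra.
move=> eps; rewrite lt_min => /andP[eps0 /andP[epse1 epsA]].
have sm : small_eps lam delta eps by apply: He1; rewrite eps0.
have epsA' : g0 * eps * expR y * (B + 1) <= 1 / 4.
  rewrite (_ : g0 * eps * expR y * (B + 1) = eps * A); last by rewrite /A; ring.
  move: epsA; rewrite ltr_pdivlMr; last lra.
  rewrite mulrDr; have : 0 <= eps * A by rewrite mulr_ge0// ltW.
  lra.
pose C := coef_bound delta lam y B.
have C0 : 0 <= C by exact: (coef_bound_ge0 y sm B0).
pose r := 1 / 8 / (C + 1).
have r0 : 0 < r by rewrite divr_gt0//; lra.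
have Cr : C * (r + r) <= 1 / 4.
  have : r * (C + 1) = 1 / 8 by rewrite /r divfK//; apply: lt0r_neq0; lra.
  by lra.
have B2 : 0 <= B ^+ 2 + L by rewrite addr_ge0 ?sqr_ge0.
have jX := jump_vanish K fF mX uX r0 B0.
have jY := jump_vanish K fF mY uY r0 B2.
move/cvgrPdist_lt : jX => /(_ r r0) jX; move/cvgrPdist_lt : jY => /(_ r r0) jY.
apply: filterS2 jX jY => n /= hX hY; set eta : R := n.+1%:R^-1.
rewrite -/eta in hX hY.
have KE : forall Z w, grid Z eta (K * n.+1) w = Z K%:R w.
  by move=> Z w; rewrite /grid natrM mulfK.
have eta0 : 0 <= eta by rewrite invr_ge0.
have gmX := grid_martingale fF mX eta0; have gmY := grid_martingale fF mY eta0.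
have M0 : 0 < expR (y - 36 * lam ^+ 2 * delta ^+ 2 * L) by exact: expR_gt0.
apply: le_trans (stopped_expo_prob y sm B0 L0 gmX gmY (K * n.+1) M0 (ltW r0)) _.
rewrite lee_fin -/g0 -/C ler_pdivrMr// -[X in _ <= X]mulrA -expRD.
rewrite (_ : - y + 36 * lam ^+ 2 * delta ^+ 2 * L +
  (y - 36 * lam ^+ 2 * delta ^+ 2 * L) = 0); last by ring.
rewrite expR0 mulr1.
have jXn : E (fun w => (jump (grid X eta) r (K * n.+1) w)%:R * (B + `|grid X eta (K * n.+1) w|)) < r.
  under eq_Rintegral do rewrite KE.
  apply: le_lt_trans (ler_norm _) _; by rewrite -normrN -sub0r.
have jYn : E (fun w => (jump (grid Y eta) r (K * n.+1) w)%:R * (B ^+ 2 + L + `|grid Y eta (K * n.+1) w|)) < r.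
  under eq_Rintegral do rewrite KE.
  apply: le_lt_trans (ler_norm _) _; by rewrite -normrN -sub0r.
have h1 := ler_wpM2l C0 (ltW jXn); have h2 := ler_wpM2l C0 (ltW jYn).
rewrite !mulrDr in Cr *.
lra.
Qed.

End ExceedLimit.

Section ExceedPath.
Context {R : realType} {d : measure_display} {T : measurableType d} (w : T).
Variables (M Q : R -> R) (m : nat) (lam y L t s : R) (k : nat).
Let delta : R := 2 ^- m.
Hypothesis cM : {within `[0, +oo[, continuous M}.
Hypothesis cQ : {within `[0, +oo[, continuous Q}.
Hypothesis M0 : M 0 = 0.
Hypothesis Q0 : Q 0 = 0.
Hypothesis ndQ : forall s t, 0 <= s -> s <= t -> Q s <= Q t.
Hypothesis st : stage M m t k s.
Hypothesis QL : Q t <= L.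
Hypothesis y0 : 0 < y.
Hypothesis Vy : y < lam * ((M t - M s) ^+ 2 + delta ^+ 2 * k%:R - Q t).

Lemma hcount_homo (delta' eps : R) (u : nat -> R) i j : (i <= j)%N ->
  hcount delta' eps u i <= hcount delta' eps u j.
Proof.
move/subnKC <-; elim: (j - i)%N => [|n IHn]; first by rewrite addn0.
by rewrite addnS (le_trans IHn)//= lerDl.
Qed.

Lemma hlevel_dist (delta' eps : R) (u : nat -> R) i : 0 <= eps <= delta' ->
  u 0%N = 0 -> (forall j, (j < i)%N -> `|u j.+1 - u j| <= eps) ->
  `|u i - hlevel delta' eps u i| <= delta'.
Proof.
move=> /andP[eps0 epsd] u0; elim: i => [|i IHi] Hu.
  by rewrite /= u0 subrr normr0; lra.
have := IHi (fun j ji => Hu j (leqW ji)); have := Hu i (leqnn _) => /=.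
set J := hlevel _ _ _ i => du; move: (u i.+1) (u i) du => u1 u2 du.
move=> uJ; rewrite ler_norml in du; rewrite ler_norml in uJ.
case: ifP => [|/negbT]; last by rewrite -ltNge ltr_norml ler_norml; lra.
have [J1|J1] := leP J u1.
  by rewrite [`|u1 - J|]ger0_norm ?subr_ge0// ler_norml; lra.
by rewrite [`|u1 - J|]ltr0_norm ?subr_lt0// ler_norml; lra.
Qed.

(** The converse, pathwise, link: if V exceeds the level at some time t, then the
grid computation notices it, at a grid time close to t where the surrogate
state is the true one. *)
Lemma exceed_path (K : nat) : t + 1 <= K%:R ->
  exists B0 : R, forall B X Y, B0 <= B ->
  (forall u, 0 <= u <= K%:R -> X u w = M u) ->
  (forall u, 0 <= u <= K%:R -> Y u w = M u ^+ 2 - Q u) ->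
  exists2 e0 : R, 0 < e0 & forall eps, 0 < eps < e0 ->
  \forall n \near \oo, let eta := (n.+1%:R : R)^-1 in
   expR (y - 36 * lam ^+ 2 * delta ^+ 2 * (L + 1)) <=
     stopped_expo (fun i w => X (i%:R * eta) w) (fun i w => Y (i%:R * eta) w)
       delta eps lam y (L + 1) B (K * n.+1) w.
Proof.
move=> tK.
have d0 : 0 < delta := @delta_gt0 R m.
have [_ /andP[s0 st'] _] := st.
have t0 : 0 <= t by exact: le_trans st'.
have K0 : 0 <= (K%:R : R) by [].
have [B1 HB1] := path_bounded cM K0.
exists (Num.max B1 k%:R) => B X Y; rewrite ge_max => /andP[B1B kB] XM YM.
pose f u := lam * ((M u - M s) ^+ 2 + delta ^+ 2 * k%:R - Q u).
have cf : {within `[0, +oo[, continuous f}.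
  move=> u; apply: cvgM; first exact: cvg_cst.
  apply: cvgB; last exact: cQ.
  apply: cvgD; last exact: cvg_cst.
  by rewrite [X in _ --> X]expr2; apply: cvgM; (apply: cvgB; [exact: cM|exact: cvg_cst]).
have fy : 0 < f t - y by rewrite subr_gt0.
have [r1 r10 Hr1] := path_continuous_at cf t0 fy.
have [r2 r20 Hr2] := path_continuous_at cQ t0 ltr01.
pose rho := Num.min (1 / 2) (Num.min (r1 / 2) (r2 / 2)).
have rho0 : 0 < rho by rewrite !lt_min; lra.
have [rh1 rh2 rh3] : [/\ rho <= 1 / 2, rho <= r1 / 2 & rho <= r2 / 2].
  by split; rewrite !ge_min lexx ?orbT.
have [e1 e10 He1] := stage_reached cM M0 st rho0.
exists (Num.min e1 delta); first by rewrite lt_min e10 d0.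
move=> eps; rewrite lt_min => /andP[eps0 /andP[epse1 epsd]].
have [|eta0 eta00 Heta] := He1 eps; first by rewrite eps0.
have [d1 d10 Hd1] := path_unif_continuous cM K%:R eps0.
have [d2 d20 Hd2] := path_unif_continuous cQ K%:R eps0.
apply: filterS3 (inv_lt_near eta00) (inv_lt_near d10) (inv_lt_near d20) => n.
set eta : R := n.+1%:R^-1; move=> etae etad1 etad2 /=.
have etap : 0 < eta by rewrite invr_gt0.
have [|i [it lev cnt]] := Heta eta; first by rewrite etap.
have ige0 j : 0 <= j%:R * eta by rewrite mulr_ge0// ltW.
have jiK j : (j <= i)%N -> 0 <= j%:R * eta <= K%:R.
  move=> ji; rewrite ige0/=.
  have : j%:R * eta <= i%:R * eta by rewrite ler_pM2r// ler_nat.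
  by move: it; rewrite ler_norml; lra.
have iK : (i <= K * n.+1)%N.
  by have /andP[_] := jiK i (leqnn _); rewrite ler_pdivrMr// -natrM ler_nat.
have XME j : (j <= i)%N -> X (j%:R * eta) w = sampled M eta j.
  by move=> ji; rewrite XM// jiK.
have levE j : (j <= i)%N -> hlevel delta eps (fun i => X (i%:R * eta) w) j =
    hlevel delta eps (sampled M eta) j.
  by elim: j => //= j IHj ji; rewrite IHj ?(ltnW ji)// XME.
have cntE j : (j <= i)%N -> hcount delta eps (fun i => X (i%:R * eta) w) j =
    hcount delta eps (sampled M eta) j.
  by elim: j => //= j IHj ji; rewrite IHj ?(ltnW ji)// XME// levE// ltnW.
have QE j : (j <= i)%N -> X (j%:R * eta) w ^+ 2 - Y (j%:R * eta) w = Q (j%:R * eta).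
  by move=> ji; rewrite XM ?jiK// YM ?jiK//; ring.
have Qge0 v : 0 <= v -> 0 <= Q v by move=> v0; rewrite -Q0; exact: ndQ.
have step j : (j < i)%N -> (j.+1)%:R * eta - j%:R * eta = eta.
  by move=> _; rewrite -mulrBl -natrB// subSnn mul1r.
have dM j : (j < i)%N -> `|sampled M eta j.+1 - sampled M eta j| <= eps.
  move=> ji; rewrite ltW//; apply: Hd1 => //; first by rewrite jiK// ltnW.
  by rewrite step// gtr0_norm.
apply: (@stopped_expo_hit _ _ _ _ _ _ _ _ _ _ _ i) => //.
- by rewrite mul0r XM ?lexx.
- by rewrite mul0r YM ?lexx// M0 Q0 expr0n subr0.
- move=> j ji; rewrite /level_ok !QE// levE// cntE// XME//; apply/and5P; split.
  + by apply: le_trans B1B; apply: HB1; exact: jiK.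
  + exact: Qge0.
  + have h1 : Q (j%:R * eta) <= Q (i%:R * eta).
      by apply: ndQ => //; rewrite ler_pM2r// ler_nat.
    have h2 : `|Q (i%:R * eta) - Q t| < 1.
      by apply: Hr2 => //; apply: le_lt_trans it _; lra.
    by move: h2; rewrite ltr_norml; have := QL; lra.
  + by apply: le_trans kB; rewrite -cnt; exact: hcount_homo.
  + apply: hlevel_dist; [by rewrite (ltW eps0) ltW| by rewrite /sampled mul0r|].
    by move=> l lj; apply: dM; exact: leq_trans ji.
- move=> j ji; rewrite /step_ok !QE// 1?ltnW// !XME// 1?ltnW//; apply/and3P; split.
  + exact: dM.
  + by rewrite subr_ge0; apply: ndQ => //; rewrite ler_pM2r// ler_nat.
  + apply: le_trans (ler_norm _) _.
    rewrite ltW//; apply: Hd2 => //; first by rewrite jiK// ltnW.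
    by rewrite step// gtr0_norm.
- rewrite /excess QE// levE// cntE// XME// lev cnt /sampled.
  have : `|f (i%:R * eta) - f t| < f t - y.
    by apply: Hr1 => //; apply: le_lt_trans it _; lra.
  by rewrite ltr_norml /f; lra.
Qed.

End ExceedPath.

(** * Tail bound for the discrete quadratic variation *)

Section OuterBounds.
Context {R : realType} {d : measure_display} {T : measurableType d}.
Variable P : probability T R.
Implicit Types (A B : set T) (b : R).

(** A bound on the outer probability: the events about the paths on a continuum
of times are not assumed to be measurable. *)
Definition outer_le A b :=
  exists2 U, measurable U /\ A `<=` U & (P U <= b%:E)%E.

Lemma outer_le_sub A B b : A `<=` B -> outer_le B b -> outer_le A b.
Proof. by move=> AB [U [mU BU] Ub]; exists U => //; split => // w /AB /BU. Qed.

Lemma outer_le_setU A B a b : outer_le A a -> outer_le B b ->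
  outer_le (A `|` B) (a + b).
Proof.
move=> [U [mU AU] Ua] [V [mV BV] Vb]; exists (U `|` V).
  by split; [exact: measurableU|exact: setUSS].
by rewrite EFinD (le_trans (measureU2 _ mU mV))// leeD.
Qed.

Lemma outer_le_negligible A : P.-negligible A -> outer_le A 0.
Proof. by move=> [U [mU U0 AU]]; exists U => //; rewrite U0. Qed.

(** Continuity from below, along the measurable tails of the covering sets. *)
Lemma outer_le_liminf (A : nat -> set T) b :
  (\forall n \near \oo, outer_le (A n) b) ->
  outer_le [set w | \forall n \near \oo, A n w] b.
Proof.
move=> [n0 _ Hn0].
have /choice[U HU] : forall n, exists U : set T,
    [/\ measurable U, A (n0 + n)%N `<=` U & (P U <= b%:E)%E].
  by move=> n; have [|U [mU AU] Ub] := Hn0 (n0 + n)%N; [exact: leq_addr|exists U].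
(* The increasing union of the W k covers the liminf, and each is inside a U k. *)
pose W k := \bigcap_j U (k + j)%N.
have mW k : measurable (W k) by apply: bigcapT_measurable => j; have [] := HU (k + j)%N.
have mUW : measurable (\bigcup_k W k) by exact: bigcup_measurable.
exists (\bigcup_k W k).
  split => // w [n1 _ Hn1]; exists n1 => // j _.
  have [_ AU _] := HU (n1 + j)%N; apply: AU; apply: Hn1 => /=.
  by rewrite addnCA leq_addr.
have ndW : nondecreasing_seq W.
  move=> k l kl; apply/subsetPset => w Wk j _.
  by have := Wk (l - k + j)%N I; rewrite addnA subnKC.
have cv := @nondecreasing_cvg_mu _ _ _ P W mW mUW ndW.
rewrite -(cvg_lim _ cv)//; apply: lime_le; first by apply/cvg_ex; eexists; exact: cv.
apply: nearW => k /=; have [mU _ Ub] := HU (k + 0)%N.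
by apply: le_trans Ub; rewrite le_measure ?inE// => w /(_ 0%N I).
Qed.

Lemma outer_le_borel_cantelli (A : nat -> set T) (C q : R) :
  0 <= C -> 0 < q < 1 ->
  (\forall n \near \oo, outer_le (A n) (C * q ^+ n)) ->
  {ae P, forall w, \forall n \near \oo, ~ A n w}.
Proof.
move=> C0 /andP[q0 q1] [n0 _ Hn0].
have /choice[U HU] : forall n, exists U : set T,
    [/\ measurable U, A (n0 + n)%N `<=` U & (P U <= (C * q ^+ (n0 + n))%:E)%E].
  by move=> n; have [|U [mU AU] Ub] := Hn0 (n0 + n)%N; [exact: leq_addr|exists U].
have mU n : measurable (U n) by have [] := HU n.
exists (lim_sup_set U); split.
- by apply: bigcapT_measurable => n; exact: bigcup_measurable.
- apply: lim_sup_set_cvg0 => //.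
  apply: le_lt_trans (ltry (C / (1 - q))).
  apply: lime_le; first exact: is_cvg_nneseries.
  apply: nearW => n.
  apply: le_trans (_ : ((\sum_(0 <= i < n) (C * q ^+ i)%R)%:E <= _)%E).
    rewrite -sumEFin; apply: lee_sum => i _; have [_ _] := HU i.
    move=> /le_trans; apply; rewrite lee_fin ler_wpM2l//.
    by rewrite exprD ler_piMl ?exprn_ge0 ?(ltW q0)// exprn_ile1// ltW.
  have -> : \sum_(0 <= i < n) C * q ^+ i = series (geometric C q) n by [].
  rewrite geometric_seriesE ?lt_eqF//= lee_fin.
  rewrite ler_wpM2r ?invr_ge0 ?subr_ge0 ?(ltW q1)// ler_piMr// gerBl.
  by rewrite exprn_ge0// ltW.
- move=> w /= Hw n _; apply: contrapT => nU; apply: Hw.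
  exists (n0 + n)%N => // k /= nk Ak; apply: nU.
  have n0k : (n0 <= k)%N by rewrite (leq_trans _ nk)// leq_addr.
  exists (k - n0)%N; first by rewrite /= -(leq_add2l n0) subnKC.
  by have [_ AU _] := HU (k - n0)%N; apply: AU; rewrite subnKC.
Qed.

End OuterBounds.

Section Tail.
Context {R : realType} {d : measure_display} {T : measurableType d}.
Variables (P : probability T R) (F : R -> set (set T)) (M Q : R -> T -> R).
Hypothesis fF : filtration F.
Hypothesis lM : continuous_local_martingale P F M.
Hypothesis vM : vanishing_at_0 P M.
Hypothesis qv : quadratic_variation P F M Q.

Definition regular (w : T) :=
  [/\ {within `[0, +oo[, continuous (M ^~ w)},
      {within `[0, +oo[, continuous (Q ^~ w)},
      M 0 w = 0, Q 0 w = 0 &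
      forall s t, 0 <= s -> s <= t -> Q s w <= Q t w].

Lemma ae_regular : {ae P, forall w, regular w}.
Proof.
have [_ cM] := lM; have [_ cQ nQ vQ _] := qv.
near=> w; split; near: w => //.
Unshelve. all: by end_near. Qed.

Variables (m : nat) (L : R).
Hypothesis L0 : 0 <= L.
Let delta : R := 2 ^- m.

Definition exceeds (lam y : R) (w : T) := exists t k s,
  [/\ stage (M ^~ w) m t k s, Q t w <= L &
   y < lam * ((M t w - M s w) ^+ 2 + delta ^+ 2 * k%:R - Q t w)].

(** Horizon K, localizing index N (which also bounds the levels), eps = 1/(l+1)
and mesh 1/(n+1) go to their limits in this order, each threshold depending on
the previous parameters. *)
Lemma exceeds_outer (lam y : R) : lam != 0 -> 0 < y ->
  outer_le P [set w | regular w /\ exceeds lam y w]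
    (2 * expR (- y + 36 * lam ^+ 2 * delta ^+ 2 * (L + 1))).
Proof.
move=> lam0 y0.
have [[aM [S [sS cS mS]]] cM] := lM.
have [_ _ _ _ [_ [S' [sS' cS' mS']]]] := qv.
pose MQ := fun t w => M t w ^+ 2 - Q t w.
pose good w := [/\ regular w, S ^~ w @ \oo --> +oo%E & S' ^~ w @ \oo --> +oo%E].
have ae_good : {ae P, forall w, good w}.
  apply: filterS3 ae_regular cS cS' => w rw [_ h1] [_ h2]; split => //.
pose b := 2 * expR (- y + 36 * lam ^+ 2 * delta ^+ 2 * (L + 1)).
pose A K N l n := [set w |
  expR (y - 36 * lam ^+ 2 * delta ^+ 2 * (L + 1)) <=
  stopped_expo (grid (stopped M (S N)) n.+1%:R^-1)
    (grid (stopped MQ (S' N)) n.+1%:R^-1) delta l.+1%:R^-1 lam y (L + 1) N%:R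
    (K * n.+1) w].
pose A' := [set w | \forall K \near \oo, \forall N \near \oo,
   \forall l \near \oo, \forall n \near \oo, A K N l n w].
have L1 : 0 <= L + 1 by rewrite addr_ge0.
have d0 : 0 < delta := @delta_gt0 R m.
have outA : outer_le P A' b.
  apply: outer_le_liminf; apply: nearW => K.
  apply: outer_le_liminf; apply: nearW => N.
  have uX : {ae P, forall w, unif_path (stopped M (S N) ^~ w)}.
    apply: filterS ae_regular => w [cMw _ _ _ _]; apply: unif_path_stopped.
      by have [+ _] := sS N; apply.
    exact: path_unif_continuous.
  have uY : {ae P, forall w, unif_path (stopped MQ (S' N) ^~ w)}.
    apply: filterS ae_regular => w [cMw cQw _ _ _]; apply: unif_path_stopped.
      by have [+ _] := sS' N; apply.
    apply: path_unif_continuous.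
    by move=> u; apply: cvgB; [rewrite expr2; apply: cvgM; exact: cMw|exact: cQw].
  have [e0 e00 He0] := grid_exceed_prob y K fF (mS N) (mS' N) uX uY d0 lam0 L1 (ler0n R N).
  apply: outer_le_liminf; apply: filterS (inv_lt_near e00) => l le0.
  apply: outer_le_liminf; have le1 : 0 < (l.+1%:R : R)^-1 < e0 by rewrite invr_gt0 ltr0n.
  apply: filterS (He0 _ le1) => n /= Hn; exists (A K N l n) => //; split => //.
  have eta0 : 0 <= (n.+1%:R : R)^-1 by rewrite invr_ge0.
  have gX := grid_martingale fF (mS N) eta0; have gY := grid_martingale fF (mS' N) eta0.
  have [sG GT _ _ _] := gX; apply: (GT (K * n.+1)%N); apply: gmeas_set => //.
  by apply: measurable_fun_ler => //; exact: (gmeas_stopped_expo _ _ _ _ _ _ gX gY).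
have := outer_le_setU outA (outer_le_negligible ae_good); rewrite addr0.
apply: outer_le_sub => w [rw [t [k [s [st QL Vy]]]]].
have [gw|] := pselect (good w); last by right.
left; have [_ cSw cSw'] := gw; have [cMw cQw M0 Q0 ndQ] := rw.
have [_ /andP[s0 st'] _] := st; have t0 : 0 <= t by exact: le_trans st'.
near=> K.
have tK : t + 1 <= K%:R.
  near: K; exists (Num.bound (t + 1)) => // K /= bK.
  by rewrite ltW// (lt_le_trans (archi_boundP _)) ?ler_nat// addr_ge0.
have [B0 HB0] := exceed_path w cMw cQw M0 Q0 ndQ st QL y0 Vy tK.
move/cvgeyPge : (cSw) => hS; move/cvgeyPge : (cSw') => hS'.
near=> N.
have B0N : B0 <= N%:R.
  near: N; exists (Num.bound `|B0|) => // N /= bN.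
  apply: le_trans (ler_norm _) _.
  by rewrite ltW// (lt_le_trans (archi_boundP _)) ?ler_nat.
have SK : (K%:R%:E <= S N w)%E by near: N; exact: hS.
have SK' : (K%:R%:E <= S' N w)%E by near: N; exact: hS'.
have XM u : 0 <= u <= K%:R -> stopped M (S N) u w = M u w.
  by move=> /andP[_ uK]; apply: stopped_before; apply: le_trans SK; rewrite lee_fin.
have YM u : 0 <= u <= K%:R -> stopped MQ (S' N) u w = M u w ^+ 2 - Q u w.
  by move=> /andP[_ uK]; rewrite stopped_before//; apply: le_trans SK'; rewrite lee_fin.
have [e0 e00 He0] := HB0 _ _ _ B0N XM YM.
apply: filterS (inv_lt_near e00) => l le0.
have le1 : 0 < (l.+1%:R : R)^-1 < e0 by rewrite invr_gt0 ltr0n.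
exact: He0 _ le1.
Unshelve. all: by end_near. Qed.

(** Apply [exceeds_outer] to lambda and to - lambda; N_m - Q and V differ by the
square of M - j, which is at most delta^2. *)
Lemma qv_tail (lam y : R) : 0 < lam -> 0 < y ->
  outer_le P [set w | exists t, [/\ 0 <= t, Q t w <= L &
      ((y / lam + delta ^+ 2)%:E <
        `|(Q t w)%:E - discrete_qv (M ^~ w) m t|)%E]]
    (4 * expR (- y + 36 * lam ^+ 2 * delta ^+ 2 * (L + 1))).
Proof.
move=> lam0 y0.
have h1 := exceeds_outer (lt0r_neq0 lam0) y0.
have h2 : outer_le P [set w | regular w /\ exceeds (- lam) y w]
    (2 * expR (- y + 36 * lam ^+ 2 * delta ^+ 2 * (L + 1))).
  by rewrite -[lam ^+ 2]sqrrN; apply: exceeds_outer; rewrite ?oppr_eq0 ?lt0r_neq0.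
have := outer_le_setU (outer_le_setU h1 h2) (outer_le_negligible ae_regular).
rewrite addr0 -mulrDl (_ : 2 + 2 = 4); last by ring.
apply: outer_le_sub => w [t [t0 QL Hq]].
have [rw|] := pselect (regular w); last by right.
left; have [cMw cQw M0 Q0 ndQ] := rw.
have [k [s st]] := stage_exists m cMw t0.
have dq := discrete_qv_stage st.
have dist := stage_dist cMw st.
have hd2 : (M t w - M s w) ^+ 2 <= delta ^+ 2 by apply: sqr_le_abs; exact: ltW.
have hd0 := sqr_ge0 (M t w - M s w).
move: Hq; rewrite dq -EFinB lte_fin => Hq.
pose V := (M t w - M s w) ^+ 2 + delta ^+ 2 * k%:R - Q t w.
have : y / lam < `|V|.
  have := ler_normB ((M t w - M s w) ^+ 2) V.
  rewrite (_ : _ - V = Q t w - delta ^+ 2 * k%:R); last by rewrite /V; ring.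
  rewrite (ger0_norm hd0); lra.
rewrite ltr_pdivrMr// => Hy.
have [V0|V0] := leP 0 V.
  by left; split => //; exists t, k, s; split => //; rewrite ger0_norm// mulrC in Hy.
by right; split => //; exists t, k, s; split => //; rewrite ltr0_norm// mulNr -mulrN mulrC in Hy *.
Qed.

End Tail.

(** * Rates of approximation *)

Section Rates.
Context {R : realType} {d : measure_display} {T : measurableType d}.
Variables (P : probability T R) (F : R -> set (set T)) (M Q : R -> T -> R).
Hypothesis fF : filtration F.
Hypothesis lM : continuous_local_martingale P F M.
Hypothesis vM : vanishing_at_0 P M.
Hypothesis qv : quadratic_variation P F M Q.

Definition deviates (m : nat) (L b : R) (w : T) := exists t, [/\ 0 <= t, Q t w <= L &
  (b%:E < `|(Q t w)%:E - discrete_qv (M ^~ w) m t|)%E].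

Lemma outer_le_le (A : set T) (a b : R) : a <= b -> outer_le P A a -> outer_le P A b.
Proof.
by move=> ab [U mU Ua]; exists U => //; apply: le_trans Ua _; rewrite lee_fin.
Qed.

Lemma qv_error_lt m (K L b c : R) w : regular M Q w -> Q K w <= L ->
  ~ deviates m L b w -> b < c ->
  (qv_error (M ^~ w) (Q ^~ w) m K < c%:E)%E.
Proof.
move=> [_ _ _ _ nd] QL ndev bc; apply: le_lt_trans (_ : (b%:E < c%:E)%E); last by rewrite lte_fin.
apply: ge_ereal_sup => _ [t /= + <-]; rewrite in_itv/= => /andP[t0 tK].
rewrite leNgt; apply/negP => h; apply: ndev; exists t; split => //.
exact: le_trans (nd _ _ t0 tK) QL.
Qed.

(** With lambda = sqrt m / delta, the penalty mu (l + 1) is 36 (l + 1) m, and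
y is about c_m m / 2: the tail is at most 4 exp (- m) once c_m is large. *)
Lemma rate_fixed_time (K : R) (c : nat -> R) :
  c @ \oo --> +oo ->
  {ae P, forall w, \forall m \near \oo,
    (qv_error (M ^~ w) (Q ^~ w) m K < (c m * Num.sqrt m%:R * 2 ^- m)%:E)%E}.
Proof.
move=> coo.
(* Q_K is not bounded: argue on {Q_K <= l} for every integer l. *)
have aeL : {ae P, forall w, forall l : nat, \forall m \near \oo,
    ~ deviates m l%:R (c m / 2 * Num.sqrt m%:R * 2 ^- m) w}.
  apply/ae_foralln => l.
  have q01 : 0 < expR (-1 : R) < 1 by rewrite expR_gt0 expR_lt1; lra.
  apply: (@outer_le_borel_cantelli _ _ _ P (fun m => deviates m l%:R _) 4 _ _ q01) => //.
  have cge : \forall m \near \oo, 72 * (l%:R + 1) + 4 <= c m.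
    by move/cvgryPge : coo; exact.
  near=> m.
  have m1 : 1 <= (m%:R : R) by rewrite ler1n; near: m; exists 1%N.
  have cm : 72 * (l%:R + 1) + 4 <= c m by near: m.
  set delta : R := 2 ^- m.
  have d0 : 0 < delta := @delta_gt0 R m.
  have d1 : delta <= 1 by rewrite invf_le1 ?exprn_gt0// exprn_ege1// ler1n.
  set r := Num.sqrt m%:R.
  have r2 : r ^+ 2 = m%:R by rewrite sqr_sqrtr.
  have r1 : 1 <= r by rewrite -[1]sqrtr1 ler_wsqrtr.
  have rm : r <= m%:R by rewrite -r2 expr2 ler_peMr//; lra.
  have l0 : 0 <= (l%:R : R) by [].
  pose lam := r / delta.
  have lam0 : 0 < lam by rewrite divr_gt0//; lra.
  pose y := lam * (c m / 2 * r * delta - delta ^+ 2).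
  have yE : y = c m / 2 * m%:R - r * delta.
    by rewrite /y /lam -r2; field; exact: lt0r_neq0.
  have rd : r * delta <= m%:R.
    by apply: le_trans rm; rewrite ler_piMr//; lra.
  have cm2 : (36 * (l%:R + 1) + 2) * m%:R <= c m / 2 * m%:R.
    by rewrite ler_wpM2r//; lra.
  have y0 : 0 < y.
    have : 0 <= 36 * (l%:R + 1) * m%:R :> R by rewrite !mulr_ge0// addr_ge0.
    by rewrite yE; lra.
  have := qv_tail fF lM vM qv m l0 lam0 y0.
  rewrite -/delta (_ : y / lam + delta ^+ 2 = c m / 2 * r * delta); last first.
    by rewrite /y mulrC mulKf ?subrK// lt0r_neq0.
  apply: outer_le_le; rewrite -expRM_natr ler_pM2l// ler_expR yE.
  rewrite (_ : 36 * lam ^+ 2 * delta ^+ 2 * (l%:R + 1) = 36 * (l%:R + 1) * m%:R); last first.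
    by rewrite /lam -r2; field; exact: lt0r_neq0.
  lra.
apply: filterS2 (ae_regular lM vM qv) aeL => w rw HL.
pose l := Num.bound `|Q K w|.
have Ql : Q K w <= l%:R.
  by rewrite (le_trans (ler_norm _))// ltW// archi_boundP.
have c1 : \forall m \near \oo, 1 <= c m by move/cvgryPge : coo; exact.
near=> m.
apply: (@qv_error_lt m K l%:R (c m / 2 * Num.sqrt m%:R * 2 ^- m) _ w rw Ql).
  by near: m; exact: (HL l).
have c1m : 1 <= c m by near: m.
rewrite ltr_pM2r ?invr_gt0 ?exprn_gt0// ltr_pM2r; first by lra.
by rewrite sqrtr_gt0 ltr0n; near: m; exists 1%N.
Unshelve. all: by end_near. Qed.

Lemma expR1_le4 : expR 1 <= 4 :> R.
Proof.
have h : expR (1 / 2) <= 2 :> R.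
  by apply: le_trans (expR_le_quad _) _; rewrite ?lexx// expr2; lra.
have -> : expR 1 = expR (1 / 2) * expR (1 / 2) :> R.
  by rewrite -expRD; congr expR; lra.
by apply: le_trans (ler_pM (expR_ge0 _) (expR_ge0 _) h h) _; lra.
Qed.

(** For a rational time q, almost surely Q_q is at most the infimum of g over
[q, +oo[, since that infimum is approached by countably many values
g t >= Q_t >= Q_q.  Then let q increase to K. *)
Lemma qv_le_envelope (g : R -> R) : (forall t, 0 < t -> 0 <= g t) ->
  (forall t, 0 < t -> {ae P, forall w, Q t w <= g t}) ->
  {ae P, forall w, forall K, 0 < K -> Q K w <= g K}.
Proof.
move=> g0 Qg.
pose h (q : R) := inf [set g t | t in [set t | q <= t]].
have hlb q : 0 < q -> has_lbound [set g t | t in [set t | q <= t]].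
  move=> q0; exists 0 => _ [t /= qt <-]; apply: g0; exact: lt_le_trans qt.
have hinf q : 0 < q -> has_inf [set g t | t in [set t | q <= t]].
  by move=> q0; split; [exists (g q), q => //=|exact: hlb].
have [_ _ nQ _ _] := qv.
pose q (i b : nat) : R := i.+1%:R * b.+1%:R^-1.
have q0 i b : 0 < q i b by rewrite mulr_gt0 ?invr_gt0.
have ae1 : {ae P, forall w, forall i b n, Q (q i b) w <= h (q i b) + n.+1%:R^-1}.
  apply/ae_foralln => i; apply/ae_foralln => b; apply/ae_foralln => n.
  have n0 : 0 < (n.+1%:R : R)^-1 by rewrite invr_gt0.
  have [_ [t /= qt <-] gt] := inf_adherent n0 (hinf _ (q0 i b)).
  have t0 : 0 < t by exact: lt_le_trans qt.
  apply: filterS2 (Qg t t0) nQ => w Qt nQw.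
  apply: le_trans (nQw _ _ (ltW (q0 i b)) qt) _.
  by apply: le_trans Qt _; exact: ltW.
apply: filterS2 (ae_regular lM vM qv) ae1 => w [_ cQ _ _ _] Hq K K0.
rewrite leNgt; apply/negP => gQ.
have e0 : 0 < (Q K w - g K) / 2 by lra.
have [r r0 Hr] := path_continuous_at cQ (ltW K0) e0.
have rK0 : 0 < Num.min r K by rewrite lt_min r0 K0.
have [b _ /(_ b (leqnn b)) Hb] := inv_lt_near rK0.
have [n _ /(_ n (leqnn n)) Hn] := inv_lt_near e0.
move: Hb; rewrite /= lt_min => /andP[br bK].
have b0 : 0 < (b.+1%:R : R)^-1 by rewrite invr_gt0.
have [[|i] /andP[iK Ki]] := grid_floor (ltW K0) b0.
  by move: Ki; rewrite mul0r add0r => /lt_trans/(_ bK); rewrite ltxx.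
have h1 := Hq i b n.
have h2 : h (q i b) <= g K by apply: ge_inf; [exact: hlb|exists K].
have : `|Q (q i b) w - Q K w| < (Q K w - g K) / 2.
  apply: Hr; first exact: ltW.
  rewrite /q; move: iK Ki br.
  move: (i.+1%:R / b.+1%:R : R) (b.+1%:R^-1 : R) => v eta h3 h4 h5.
  by rewrite ltr_norml; lra.
move: Hn h1 h2; rewrite /= ltr_norml.
by move: (h _) (Q _ w) (Q K w) (n.+1%:R^-1 : R) => *; lra.
Qed.

(** Only the integer j with e^j <= g(K) < e^(j+1) matters.  With
lambda = sqrt (j / e^j), y is about j / 2, and the penalty mu (e^(j+1) + 1) is at
most 180 delta^2 j, hence negligible with respect to y when m is large. *)
Lemma rate_large_time (g : R -> R) (m : nat) : (12 <= m)%N ->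
  (forall t : R, 0 < t -> Num.max t (expR 1) <= g t) ->
  (forall t : R, 0 < t -> {ae P, forall w, Q t w <= g t}) ->
  {ae P, forall w, \forall K \near +oo,
    (qv_error (M ^~ w) (Q ^~ w) m K
      < (Num.sqrt (g K) * Num.sqrt (ln (g K)))%:E)%E}.
Proof.
move=> m12 gge Qg.
have ge_e t : 0 < t -> expR 1 <= g t.
  by move=> /gge; rewrite ge_max => /andP[].
have ge_t t : 0 < t -> t <= g t.
  by move=> /gge; rewrite ge_max => /andP[].
pose L (j : nat) : R := expR j.+1%:R.
pose s (j : nat) : R := Num.sqrt (expR j%:R).
pose r (j : nat) : R := Num.sqrt j%:R.
have aeJ : {ae P, forall w, \forall j \near \oo,
    ~ deviates m (L j) (s j * r j / 2) w}.
  have q01 : 0 < expR (- (1 / 4) : R) < 1 by rewrite expR_gt0 expR_lt1; lra.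
  apply: (@outer_le_borel_cantelli _ _ _ P (fun j => deviates m (L j) _) 4 _ _ q01) => //.
  near=> j.
  have j1 : 1 <= j%:R :> R by rewrite ler1n; near: j; exists 1%N.
  set delta : R := 2 ^- m.
  have d0 : 0 < delta := @delta_gt0 R m.
  (* The bound 12 on m is chosen so that 180 delta^2 <= 1/8 below. *)
  have dd : 4096 * delta <= 1.
    rewrite /delta -(subnKC m12) exprD invfM mulrA.
    rewrite (_ : 4096 / 2 ^+ 12 = 1); last by field.
    by rewrite mul1r invf_le1 ?exprn_gt0// exprn_ege1// ler1n.
  have d2 : 4096 * delta ^+ 2 <= 1.
    rewrite expr2 mulrA; apply: le_trans (_ : 1 * delta <= _); first by rewrite ler_wpM2r// ltW.
    lra.
  have L0 : 0 <= L j by exact: expR_ge0.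
  have s2 : s j ^+ 2 = expR j%:R by rewrite sqr_sqrtr// expR_ge0.
  have r2 : r j ^+ 2 = j%:R by rewrite sqr_sqrtr.
  have r1 : 1 <= r j by rewrite -[1]sqrtr1 ler_wsqrtr.
  have ej : j%:R <= expR j%:R :> R by apply: le_trans (expR_ge1Dx _); rewrite lerDr.
  have rs : r j <= s j by rewrite ler_wsqrtr.
  have s0 : 0 < s j by lra.
  pose lam := r j / s j.
  have lam0 : 0 < lam by rewrite divr_gt0//; lra.
  have lam1 : lam <= 1 by rewrite ler_pdivrMr// mul1r.
  pose y := lam * (s j * r j / 2 - delta ^+ 2).
  have yE : y = j%:R / 2 - lam * delta ^+ 2.
    by rewrite /y mulrBr /lam -r2; congr (_ - _); field; exact: lt0r_neq0.
  have ld : lam * delta ^+ 2 <= delta ^+ 2 by rewrite ler_piMl// sqr_ge0.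
  have y0 : 0 < y by rewrite yE; lra.
  have := qv_tail fF lM vM qv m L0 lam0 y0.
  rewrite -/delta (_ : y / lam + delta ^+ 2 = s j * r j / 2); last first.
    by rewrite /y mulrC mulKf ?subrK// lt0r_neq0.
  apply: outer_le_le; rewrite -expRM_natr ler_pM2l// ler_expR.
  (* The penalty is lambda^2 (L + 1) times 36 delta^2, and e <= 4. *)
  have lamL : lam ^+ 2 * (L j + 1) <= 5 * j%:R.
    have h1 : L j + 1 <= 5 * expR j%:R.
      rewrite /L -natr1 expRD; have := expR1_le4; have := expR_ge1Dx (j%:R : R).
      have := expR_gt0 (j%:R : R); move: (expR j%:R) (expR 1) => a b a0 a1 b4.
      have : a * b <= a * 4 by rewrite ler_pM2l.
      lra.
    apply: le_trans (ler_wpM2l (sqr_ge0 lam) h1) _.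
    rewrite /lam -s2 -r2.
    rewrite (_ : (r j / s j) ^+ 2 * (5 * s j ^+ 2) = 5 * r j ^+ 2)//.
    by field; exact: lt0r_neq0.
  have : 36 * lam ^+ 2 * delta ^+ 2 * (L j + 1) <= 180 * delta ^+ 2 * j%:R.
    rewrite (_ : 36 * lam ^+ 2 * delta ^+ 2 * (L j + 1) =
      36 * delta ^+ 2 * (lam ^+ 2 * (L j + 1))); last by ring.
    rewrite (_ : 180 * delta ^+ 2 * j%:R = 36 * delta ^+ 2 * (5 * j%:R)); last by ring.
    by rewrite ler_wpM2l// mulr_ge0 ?sqr_ge0.
  have : 180 * delta ^+ 2 * j%:R <= 1 / 8 * j%:R.
    by rewrite ler_wpM2r//; lra.
  rewrite yE; lra.
have g0 t : 0 < t -> 0 <= g t by move=> t0; apply: le_trans (ge_t t t0); exact: ltW.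
apply: filterS3 (ae_regular lM vM qv) aeJ (qv_le_envelope g0 Qg) => w rw [j0 _ HJ] Qgw.
near=> K.
have K0 : 0 < K by near: K; exact: nbhs_pinfty_gt.
have gK0 : 0 < g K by exact: lt_le_trans (ge_t K K0).
have eK := ge_e K K0.
have lng1 : 1 <= ln (g K) by rewrite -[1]expRK ler_ln ?posrE ?expR_gt0.
have := truncn_itv (le_trans ler01 lng1).
set j := Num.truncn _ => /andP[jl lj].
have jj0 : (j0 <= j)%N.
  rewrite -ltnS -(ltr_nat R); apply: le_lt_trans lj.
  rewrite -[j0%:R]expRK ler_ln ?posrE ?expR_gt0//.
  apply: le_trans (ge_t K K0).
  by near: K; apply: nbhs_pinfty_ge; exact: num_real.
have egK : expR (ln (g K)) = g K by rewrite lnK// posrE.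
have QL : Q K w <= L j.
  apply: le_trans (Qgw K K0) _; rewrite -[g K]lnK ?posrE// /L ler_expR.
  exact: ltW.
apply: (@qv_error_lt m K (L j) (s j * r j / 2) _ w rw QL); first exact: HJ.
have sg : s j <= Num.sqrt (g K).
  by rewrite ler_wsqrtr// -[g K]lnK ?posrE// ler_expR.
have rg : r j <= Num.sqrt (ln (g K)) by rewrite ler_wsqrtr.
have sp : 0 < Num.sqrt (g K) * Num.sqrt (ln (g K)).
  by rewrite mulr_gt0// sqrtr_gt0//; exact: lt_le_trans lng1.
have : s j * r j <= Num.sqrt (g K) * Num.sqrt (ln (g K)).
  by rewrite ler_pM// sqrtr_ge0.
lra.
Unshelve. all: by end_near. Qed.

End Rates.

Unset Implicit Arguments.
Set Strict Implicit.

Theorem theorem2 (R : realType) :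
  (forall (d : measure_display) (T : measurableType d) (P : probability T R)
      (F : R -> set (set T)) (M Q : R -> T -> R),
    filtration F ->
    continuous_local_martingale P F M -> vanishing_at_0 P M ->
    quadratic_variation P F M Q ->
    forall (K : R) (c : nat -> R),
      0 < K -> nondecreasing_seq c -> c @ \oo --> +oo ->
      {ae P, forall w, \forall m \near \oo,
        (qv_error (M ^~ w) (Q ^~ w) m K
           < (c m * Num.sqrt m%:R * 2 ^- m)%:E)%E})
  /\
  (exists m4 : nat, (0 < m4)%N /\
    forall (d : measure_display) (T : measurableType d) (P : probability T R)
      (F : R -> set (set T)) (M Q : R -> T -> R),
    filtration F ->
    continuous_local_martingale P F M -> vanishing_at_0 P M ->
    quadratic_variation P F M Q ->
    forall g : R -> R,
      (forall t : R, 0 < t -> Num.max t (expR 1) <= g t) ->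
      (forall t : R, 0 < t -> {ae P, forall w, Q t w <= g t}) ->
      forall m : nat, (m4 <= m)%N ->
      {ae P, forall w, \forall K \near +oo,
        (qv_error (M ^~ w) (Q ^~ w) m K
           < (Num.sqrt (g K) * Num.sqrt (ln (g K)))%:E)%E}).
Proof.
split.
  move=> d T P F M Q fF lM vM qv K c _ _ coo.
  exact: (@rate_fixed_time _ _ _ P F M Q fF lM vM qv K c coo).
exists 12%N; split => // d T P F M Q fF lM vM qv g gge Qg m m12.
exact: (@rate_large_time _ _ _ P F M Q fF lM vM qv g m m12 gge Qg).
Qed.
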